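(* Let $(x_k,y_k)\in\mathbb{Z}^d\times\mathbb{Z}^d$ $(1\le k\le N-1)$ and $(\alpha,\beta)\in(\mathbb{R}^d\times\mathbb{R}^d)\setminus(\mathbb{Z}^d\times\mathbb{Z}^d)$, and assume that $0\ne f\in\mathcal{S}(\mathbb{R}^d)$ and $c_1,\dots,c_{N-1}\in\mathbb{C}$ satisfy $\sum_{k=1}^{N-1}c_kM_{y_k}T_{x_k}f=M_\beta T_\alpha f$. Assume that $H=\overline{\{n(-\alpha,\beta)\bmod\mathbb{Z}^{2d}:n\in\mathbb{Z}\}}\subset\mathbb{T}^{2d}$ is infinite and proper. Let $H_0$ be the identity component of $H$, let $m=|H/H_0|$, and let $\mathfrak h=T_0H_0\subset\mathbb{R}^{2d}$. Then for every $a=(a_t,a_\omega)\in\mathfrak h\cap\mathbb{Z}^{2d}$ (with $a_t,a_\omega\in\mathbb{R}^d$) one has $$m\bigl(\langle a_t,\beta\rangle+\langle a_\omega,\alpha\rangle\bigr)\in\mathbb{Z}.$$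
   Context: Here $d\ge1$, $N\ge2$ are integers, $\langle\cdot,\cdot\rangle$ is the standard inner product on $\mathbb{R}^d$, $\mathcal{S}(\mathbb{R}^d)$ is the Schwartz space, and $\mathbb{T}^{n}=\mathbb{R}^{n}/\mathbb{Z}^{n}$. Time-frequency shifts: $T_xf(t)=f(t-x)$, $M_yf(t)=e^{-2\pi i\langle y,t\rangle}f(t)$. $H$ is a closed subgroup of $\mathbb{T}^{2d}$, hence a compact abelian Lie group; ''proper'' means $H\ne\mathbb{T}^{2d}$, and $H/H_0$ is finite. $T_0H_0$ is the tangent space (Lie algebra) of $H_0$ at the identity, viewed as a linear subspace of $\mathbb{R}^{2d}$, so that $H_0$ is the image of $T_0H_0$ in $\mathbb{T}^{2d}$. *)

(* Defs.v *)
From HB Require Import structures.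
From mathcomp Require Import all_boot all_order all_algebra.
From mathcomp Require Import generic_quotient ring_quotient.
From mathcomp Require Import all_classical all_reals all_analysis.
From mathcomp Require Import complex.

Set Implicit Arguments.
Unset Strict Implicit.
Unset Printing Implicit Defensive.

Import Order.TTheory GRing.Theory Num.Theory.
Import numFieldNormedType.Exports.

Local Open Scope classical_set_scope.
Local Open Scope quotient_scope.
Local Open Scope complex_scope.
Local Open Scope ring_scope.

(* R^n is 'rV[R]_n; R^(2d) is 'rV[R]_(d + d), whose point (u, v) with
   u, v in R^d is row_mx u v. *)

Section Torus.
Variables (R : realType) (n : nat).

Definition int_lattice : {pred 'rV[R]_n} := fun v => v \is a mxOver Num.int.

Lemma int_lattice_closed : zmod_closed int_lattice.
Proof.
split=> [|u v /mxOverP uZ /mxOverP vZ]; apply/mxOverP=> i j; rewrite !mxE ?rpred0//.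
by apply: rpredB; [exact: uZ|exact: vZ].
Qed.

HB.instance Definition _ :=
  GRing.isZmodClosed.Build 'rV[R]_n int_lattice int_lattice_closed.

(* R^n / Z^n, with the quotient group structure and the quotient topology. *)
Definition torus : Type := quotient_topology (Quotient.quot int_lattice).

HB.instance Definition _ := GRing.Zmodule.copy torus (Quotient.quot int_lattice).
HB.instance Definition _ :=
  Topological.copy torus (quotient_topology (Quotient.quot int_lattice)).

Definition to_torus (v : 'rV[R]_n) : torus := \pi_(Quotient.quot int_lattice) v.

(* Velocities at the identity of differentiable curves in K through the
   identity. Such a curve is given by its lift to R^n through the covering
   map to_torus, which identifies the tangent space of the torus at the
   identity with R^n. *)
Definition tangent_space (K : set torus) : set 'rV[R]_n :=
  [set v : 'rV[R]_n | exists g : R -> 'rV[R]_n,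
     [/\ g 0 = 0, forall s, derivable g s 1, 'D_1 g 0 = v
       & forall s, K (to_torus (g s))]].

Definition identity_component (K : set torus) : set torus :=
  connected_component K 0.

End Torus.

Definition cosets (V : zmodType) (A B : set V) : set (set V) :=
  [set [set a + b | b in B] | a in A].

Definition dot (R : realType) (d : nat) (u v : 'rV[R]_d) : R :=
  \sum_(j < d) u 0 j * v 0 j.

Section TimeFrequency.
Variables (R : realType) (d : nat).
Implicit Types (f : 'rV[R]_d -> R[i]) (x y t : 'rV[R]_d).

Definition expi (s : R) : R[i] := cos s +i* sin s.

Definition translation x f : 'rV[R]_d -> R[i] := fun t => f (t - x).

Definition modulation y f : 'rV[R]_d -> R[i] :=
  fun t => expi (- (2 * pi * dot y t)) * f t.

(* Partial derivatives of a complex-valued function are taken on its real and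
   imaginary parts, as R[i] carries no normed R-module structure. *)
Definition partial (j : 'I_d) f : 'rV[R]_d -> R[i] :=
  fun t => 'D_(delta_mx 0 j) (@complex.Re R \o f) t
        +i* 'D_(delta_mx 0 j) (@complex.Im R \o f) t.

(* Multi-indices are encoded as lists of directions, so partials s f runs over
   all mixed partial derivatives of f. *)
Definition partials (s : seq 'I_d) f : 'rV[R]_d -> R[i] := foldr partial f s.

Definition smooth f : Prop := forall (s : seq 'I_d) t,
  differentiable (@complex.Re R \o partials s f) t /\
  differentiable (@complex.Im R \o partials s f) t.

Definition schwartz f : Prop := smooth f /\
  forall (k : 'I_d -> nat) (s : seq 'I_d), exists C : R, forall t,
    `|(\prod_(j < d) t 0 j ^+ k j)%:C * partials s f t| <= C%:C.

Definition orbit_closure (alpha beta : 'rV[R]_d) : set (torus R (d + d)) :=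
  closure (range (fun n : int => to_torus (row_mx (- alpha) beta *~ n))).

End TimeFrequency.

(* Main.v *)
Require Import Defs.
From HB Require Import structures.
From mathcomp Require Import all_boot all_order all_algebra.
From mathcomp Require Import finmap generic_quotient ring_quotient.
From mathcomp Require Import all_classical all_reals all_analysis.
From mathcomp Require Import complex ring lra zify.

(** Let [F] be the Zak transform of [f],
    [F (t, w) = \sum_(k in Z^d) f (t + k) e^(- 2 i pi <k, w>)], a continuous
    function on R^(2d), not identically zero. Under a lattice translation it is
    multiplied by a unimodular function ([quasi_periodic]): it is a section of
    a line bundle on the torus T^(2d), whose curvature is the symplectic form
    [symp]. The linear relation satisfied by [f] becomes
    [P * F = unimodular * F (. + xi)], with [P] a trigonometric polynomial and
    [xi = (- alpha, beta)], so the zeros of [F] are carried by forward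
    translations along [xi] ([zak_zero_shift]). Forward multiples of [xi] are
    dense in the closed subgroup [H] they generate, by Dirichlet's theorem;
    hence if [F z != 0], then [F] has no zero on the coset [z + H]
    ([nonzero_on_orbit_closure]).

    A nowhere vanishing section over the coset leaves no room for curvature
    there. Concretely, let [a] and [v] be short vectors in the preimage [L] of
    [H] in R^(2d). The phase gained by [F] around each parallelogram spanned by
    [a] and [v] is [symp a v]. Adding these up over an [n x n] grid gives
    [n^2 symp a v], while only the [4 n] boundary edges contribute, each by a
    bounded amount because [|F|] is bounded below on the coset. Therefore
    [symp a v = 0] ([isotropic_near0]).

    If [a] is tangent to [H], then the short vectors [a / k] lie in [L]
    ([tangent_line]), so [symp a] vanishes on all short vectors of [L]. If
    moreover [a] is integral, [symp a] modulo the integers is a character of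
    [H], trivial near the identity, hence on the identity component [H0]
    ([symp_int_on_component]). As [H / H0] has [m] elements, the character takes
    the value [m * symp a xi = 0] modulo the integers on [m xi]
    ([cosets_exponent]), and
    [symp a xi = <a_t, beta> + <a_w, alpha>]. *)

Set Implicit Arguments.
Unset Strict Implicit.
Unset Printing Implicit Defensive.

Import Order.TTheory GRing.Theory Num.Theory.
Import numFieldNormedType.Exports.

Local Open Scope classical_set_scope.
Local Open Scope card_scope.
Local Open Scope ring_scope.

(** * Unordered sums *)

Section UnorderedSums.
Variables (K : numFieldType) (I : choiceType).
Implicit Types (g : I -> K) (S : K) (A : {fset I}).

(** Convergence along the net of finite index sets. No enumeration of the
    index set enters, so a sum over Z^d can be translated at no cost. *)
Definition has_sum g S : Prop := forall e : K, 0 < e ->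
  exists A0 : {fset I}, forall A, (A0 `<=` A)%fset -> `|\sum_(i <- A) g i - S| < e.

Lemma has_sum_unique g S S' : has_sum g S -> has_sum g S' -> S = S'.
Proof.
move=> gS gS'; apply/eqP; rewrite -subr_eq0 -normr_le0.
case: (boolP (`|S - S'| == 0)) => [/eqP->//|n0].
have p0 : 0 < `|S - S'| / 2 by rewrite divr_gt0// lt0r n0 normr_ge0.
have [A hA] := gS _ p0; have [B hB] := gS' _ p0.
have hAi := hA _ (fsubsetUl A B); have hBi := hB _ (fsubsetUr A B).
set T := \sum_(i <- _) _ in hAi hBi.
have : `|S - S'| < `|S - S'|.
  rewrite {1}(_ : S - S' = (T - S') - (T - S)); last by ring.
  apply: le_lt_trans (ler_normB _ _) _.
  by rewrite (splitr (`|S - S'|)) ltrD.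
by rewrite ltxx.
Qed.

Lemma has_sum0 : has_sum (fun=> 0) 0.
Proof. by move=> e e0; exists fset0 => A _; rewrite big1// subr0 normr0. Qed.

Lemma has_sumD g h S T :
  has_sum g S -> has_sum h T -> has_sum (fun i => g i + h i) (S + T).
Proof.
move=> gS hT e e0; have p0 : 0 < e / 2 by rewrite divr_gt0.
have [A hA] := gS _ p0; have [B hB] := hT _ p0.
exists (A `|` B)%fset => C /fsubUsetP[AC BC]; rewrite big_split/=.
rewrite (_ : _ - _ = (\sum_(i <- C) g i - S) + (\sum_(i <- C) h i - T)); last by ring.
by apply: le_lt_trans (ler_normD _ _) _; rewrite (splitr e) ltrD ?hA ?hB.
Qed.

Lemma has_sumZ (a : K) g S : has_sum g S -> has_sum (fun i => a * g i) (a * S).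
Proof.
move=> gS e e0; have p0 : 0 < e / (`|a| + 1) by rewrite divr_gt0// ltr_wpDl.
have [A hA] := gS _ p0; exists A => B AB.
rewrite -mulr_sumr -mulrBr normrM.
apply: (@le_lt_trans _ _ (`|a| * (e / (`|a| + 1)))).
  by rewrite ler_wpM2l// ltW// hA.
by rewrite mulrCA gtr_pMr// ltr_pdivrMr ?ltr_wpDl// mul1r ltrDl.
Qed.

Lemma has_sum_sum (J : Type) (s : seq J) (g : J -> I -> K) (S : J -> K) :
  (forall j, has_sum (g j) (S j)) ->
  has_sum (fun i => \sum_(j <- s) g j i) (\sum_(j <- s) S j).
Proof.
move=> gS; elim: s => [|j s IH].
  by rewrite big_nil; under eq_fun do rewrite big_nil; exact: has_sum0.
by rewrite big_cons; under eq_fun do rewrite big_cons; exact: has_sumD.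
Qed.

Lemma has_sum_reindex (h h' : I -> I) g S :
  cancel h h' -> cancel h' h -> has_sum g S -> has_sum (g \o h) S.
Proof.
move=> hK h'K gS e e0; have [A hA] := gS _ e0.
exists [fset h' i | i in A]%fset => B AB.
have -> : \sum_(i <- B) (g \o h) i = \sum_(i <- [fset h i | i in B]%fset) g i.
  by rewrite big_imfset//= => i j _ _; exact: (can_inj hK).
apply: hA; apply/fsubsetP => i iA; rewrite -(h'K i) in_imfset//=.
by apply: (fsubsetP AB); rewrite in_imfset.
Qed.

Lemma has_sum_le (B : K) (A0 : {fset I}) g S : has_sum g S ->
  (forall A, (A0 `<=` A)%fset -> `|\sum_(i <- A) g i - \sum_(i <- A0) g i| <= B) ->
  forall e, 0 < e -> `|S - \sum_(i <- A0) g i| < B + e.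
Proof.
move=> gS gB e e0; have [A hA] := gS _ e0.
have := hA _ (fsubsetUr A0 A); have := gB _ (fsubsetUl A0 A).
set T := \sum_(i <- _) _ => TB TS.
rewrite (_ : _ - _ = (T - \sum_(i <- A0) g i) - (T - S)); last by ring.
by apply: le_lt_trans (ler_normB _ _) _; rewrite ler_ltD.
Qed.

End UnorderedSums.

Section Domination.
Variables (R : realType) (I : choiceType).
Implicit Types (u : I -> R) (A : {fset I}).

Definition bounded_sums u := exists B : R, forall A, \sum_(i <- A) u i <= B.

Lemma sum_fset_sub u A B : (forall i, 0 <= u i) -> (A `<=` B)%fset ->
  \sum_(i <- A) u i <= \sum_(i <- B) u i.
Proof.
move=> u0 AB; rewrite [leRHS](big_fsetID _ (mem A))/=.
have -> : [fset x | x in B & x \in A]%fset = A.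
  apply/fsetP => i; rewrite !inE/= andbC.
  by case: (boolP (i \in A)) => //= iA; rewrite (fsubsetP AB).
by rewrite lerDl sumr_ge0.
Qed.

(** A monotone bounded net converges to its supremum. *)
Lemma has_sum_ge0 u : (forall i, 0 <= u i) -> bounded_sums u ->
  exists S, has_sum u S.
Proof.
move=> u0 [B uB].
pose E := [set \sum_(i <- A) u i | A in [set: {fset I}]].
have hE : has_sup E.
  by split; [exists (\sum_(i <- fset0) u i), fset0|exists B => _ [A _ <-]].
exists (sup E) => e e0.
have [_ [A0 _ <-] hA0] := sup_adherent e0 hE.
exists A0 => A AA0.
have h1 : \sum_(i <- A) u i <= sup E by apply: sup_upper_bound => //; exists A.
have h2 := sum_fset_sub u0 AA0.
by rewrite ler0_norm ?subr_le0//; lra.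
Qed.

Lemma small_tails u : (forall i, 0 <= u i) -> bounded_sums u ->
  forall e, 0 < e -> exists A0 : {fset I}, forall A, (A0 `<=` A)%fset ->
    \sum_(i <- A) u i - \sum_(i <- A0) u i < e.
Proof.
move=> u0 uB e e0; have [S hS] := has_sum_ge0 u0 uB.
have p0 : 0 < e / 2 by rewrite divr_gt0.
have [A0 hA0] := hS _ p0; exists A0 => A AA0.
have := hA0 _ AA0; have := hA0 _ (fsubset_refl _).
by rewrite !ltr_norml => /andP[? ?] /andP[? ?]; lra.
Qed.

(** Write [g = (u + g) - u], a difference of nonnegative families. *)
Lemma has_sum_dominated_real u (g : I -> R) : bounded_sums u ->
  (forall i, `|g i| <= u i) -> exists S, has_sum g S.
Proof.
move=> [B uB] gu.
have u0 i : 0 <= u i by exact: le_trans (gu i).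
have [||S hS] := @has_sum_ge0 (fun i => u i + g i).
- by move=> i; have := gu i; rewrite ler_norml => /andP[? _]; lra.
- exists (B + B) => A; rewrite big_split/= lerD//.
  by apply: le_trans (uB A); apply: ler_sum => i _; apply: le_trans (gu i); exact: ler_norm.
have [|T hT] := @has_sum_ge0 u u0; first by exists B.
exists (S + -1 * T).
rewrite (_ : g = (fun i => (u i + g i) + -1 * u i)); last by apply/funext => i; ring.
by apply: has_sumD => //; exact: has_sumZ.
Qed.

Lemma has_sum_real_complex (g : I -> R) S :
  has_sum g S -> has_sum (fun i => (g i)%:C)%C S%:C%C.
Proof.
move=> gS e; rewrite ltcE /= => /andP[/eqP e0 ep].
have [A0 hA0] := gS _ ep; exists A0 => A /hA0 h.
rewrite -rmorph_sum -rmorphB normc_def/= expr0n addr0 sqrtr_sqr.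
by case: e e0 {ep hA0} h => a b /= -> h; rewrite ltcR.
Qed.

Lemma has_sum_dominated u (g : I -> R[i]) : bounded_sums u ->
  (forall i, `|g i| <= (u i)%:C%C) -> exists S, has_sum g S.
Proof.
move=> uB gu.
have gre i : `|complex.Re (g i)| <= u i /\ `|complex.Im (g i)| <= u i.
  have := gu i; rewrite normc_def lecR => h.
  by split; apply: le_trans h; rewrite -sqrtr_sqr ler_sqrt ?addr_ge0 ?sqr_ge0//;
    rewrite ?lerDl ?lerDr sqr_ge0.
have [S hS] := has_sum_dominated_real uB (fun i => (gre i).1).
have [T hT] := has_sum_dominated_real uB (fun i => (gre i).2).
exists (S%:C + 'i * T%:C)%C.
rewrite (_ : g = (fun i => (complex.Re (g i))%:C + 'i * (complex.Im (g i))%:C)%C).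
  by apply: has_sumD; [|apply: has_sumZ]; exact: has_sum_real_complex.
by apply/funext => i; rewrite -complexE.
Qed.

(** The error made by truncating to [A0] is governed by the dominating family
    only; this uniformity makes sums depend continuously on parameters. *)
Lemma has_sum_tail u (g : I -> R[i]) S (A0 : {fset I}) (e : R) :
  (forall i, `|g i| <= (u i)%:C%C) ->
  (forall A, (A0 `<=` A)%fset -> \sum_(i <- A) u i - \sum_(i <- A0) u i < e) ->
  has_sum g S -> 0 < e -> `|S - \sum_(i <- A0) g i| < (e + e)%:C%C.
Proof.
move=> gu uA0 gS e0; rewrite rmorphD /=; apply: (has_sum_le gS); last by rewrite ltcR.
move=> A A0A.
have split (V : zmodType) (h : I -> V) : \sum_(i <- A) h i - \sum_(i <- A0) h i =
    \sum_(i <- A | i \notin A0) h i.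
  rewrite (bigID (mem A0))/= (_ : \sum_(i <- A | i \in A0) h i = \sum_(i <- A0) h i).
    by rewrite addrAC subrr add0r.
  rewrite -big_filter; apply: perm_big; apply: uniq_perm => //; first exact: filter_uniq.
  move=> i; rewrite mem_filter/=.
  by case: (boolP (i \in A0)) => //= iA; rewrite (fsubsetP A0A).
apply: (@le_trans _ _ (\sum_(i <- A) u i - \sum_(i <- A0) u i)%:C%C); last first.
  by rewrite lecR ltW// uA0.
rewrite !split rmorph_sum/=; apply: le_trans (ler_norm_sum _ _ _) _.
by apply: ler_sum => i _.
Qed.

End Domination.

(** * Characters, the integer lattice and a summable weight *)

Section Characters.
Variable R : realType.
Implicit Types s : R.

Definition e2pi s : R[i] := expi (2 * pi * s).

Lemma e2pi0 : e2pi 0 = 1.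
Proof. by rewrite /e2pi /expi mulr0 cos0 sin0. Qed.

Lemma e2piD s t : e2pi (s + t) = e2pi s * e2pi t.
Proof.
rewrite /e2pi /expi mulrDr cosD sinD; apply/eqP; rewrite eq_complex/=.
by rewrite eqxx/=; apply/eqP; ring.
Qed.

Lemma e2pi_conj s : (e2pi s)^*%C = e2pi (- s).
Proof. by rewrite /e2pi /expi/= mulrN cosN sinN. Qed.

Lemma e2piNM s : e2pi (- s) * e2pi s = 1.
Proof. by rewrite -e2piD addNr e2pi0. Qed.

Lemma norm_e2pi s : `|e2pi s| = 1.
Proof. by rewrite normc_def/= cos2Dsin2 sqrtr1. Qed.

Lemma e2pi_neq0 s : e2pi s != 0.
Proof. by rewrite -normr_eq0 norm_e2pi oner_eq0. Qed.

Lemma e2piX s n : e2pi s ^+ n = e2pi (s *+ n).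
Proof. by elim: n => [|n IH]; rewrite ?e2pi0// exprS mulrS IH e2piD. Qed.

Lemma e2pi_nat n : e2pi n%:R = 1.
Proof.
rewrite -[n%:R]mulr_natl mulr1 -e2piX (_ : e2pi 1 = 1) ?expr1n//.
by rewrite /e2pi /expi mulr1 mulr_natl cos2pi sin2pi.
Qed.

Lemma e2pi_int s : s \is a Num.int -> e2pi s = 1.
Proof.
move=> /intrP[[n|n] ->]; first exact: e2pi_nat.
by rewrite NegzE mulrNz -e2pi_conj e2pi_nat conjc1.
Qed.

(** Reduce to the fractional part of [s], or to its reflection about [1/2],
    so that the angle falls in [0, pi], where cosine is injective. *)
Lemma e2pi_eq1 s : e2pi s = 1 -> s \is a Num.int.
Proof.
have small r : 0 <= r <= 2^-1 -> e2pi r = 1 -> r = 0.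
  move=> /andP[r0 r2] [cr _].
  have p0 := @pi_gt0 R.
  have : 2 * pi * r = 0 :> R.
    apply: cos_inj; last by rewrite cos0.
      rewrite in_itv/=; apply/andP; split; first by rewrite !mulr_ge0// ltW.
      by rewrite (_ : 2 * pi * r = pi * (2 * r)); [rewrite ger_pMr//; lra|ring].
    by rewrite in_itv/= lexx ltW.
  by move/eqP; rewrite !mulf_eq0 pnatr_eq0 (gt_eqF p0)/= => /eqP.
move=> es; set n := Num.floor s.
have [n1 n2] : n%:~R <= s /\ s < n%:~R + 1.
  by have := real_floor_itv (num_real s); rewrite intrD => /andP[? ?].
have er : e2pi (s - n%:~R) = 1.
  by rewrite e2piD es mul1r -e2pi_conj e2pi_int ?conjc1// intr_int.
have [le|gt] := lerP (s - n%:~R) 2^-1.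
  have : s - n%:~R = 0 by apply: small => //; lra.
  by move/eqP; rewrite subr_eq0 => /eqP ->; rewrite intr_int.
have e1 : e2pi (1 - (s - n%:~R)) = 1.
  by rewrite e2piD -e2pi_conj er conjc1 mulr1 (e2pi_nat 1).
have : 1 - (s - n%:~R) = 0 by apply: small => //; lra.
by move=> h; exfalso; clear es er e1; lra.
Qed.

End Characters.

Section Lattice.
Variables (R : realType) (d : nat).
Implicit Types (u v t : 'rV[R]_d) (k : 'rV[int]_d).

(** The lattice Z^d is indexed by integer vectors, which form a group. *)
Definition intv k : 'rV[R]_d := map_mx intr k.

Lemma intv0 : intv 0 = 0.
Proof. by apply/rowP => j; rewrite !mxE. Qed.

Lemma intvD k l : intv (k + l) = intv k + intv l.
Proof. exact: map_mxD. Qed.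

Lemma intvN k : intv (- k) = - intv k.
Proof. exact: map_mxN. Qed.

Lemma int_latticeP v : reflect (exists k, v = intv k) (v \in @int_lattice R d).
Proof.
apply: (iffP mxOverP) => [h|[k ->] i j]; last by rewrite mxE intr_int.
exists (\row_j Num.floor (v 0 j)); apply/rowP => j; rewrite !mxE.
by apply/esym/eqP; rewrite -intrEfloor h.
Qed.

Lemma dotC u v : dot u v = dot v u.
Proof. by apply: eq_bigr => j _; rewrite mulrC. Qed.

Lemma dotDl u v w : dot (u + v) w = dot u w + dot v w.
Proof. by rewrite -big_split; apply: eq_bigr => j _; rewrite mxE mulrDl. Qed.

Lemma dotDr u v w : dot w (u + v) = dot w u + dot w v.
Proof. by rewrite dotC dotDl !(dotC w). Qed.

Lemma dotZl a u v : dot (a *: u) v = a * dot u v.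
Proof. by rewrite mulr_sumr; apply: eq_bigr => j _; rewrite mxE mulrA. Qed.

Lemma dot0r u : dot u 0 = 0.
Proof. by rewrite /dot big1// => j _; rewrite mxE mulr0. Qed.

Lemma dotNl u v : dot (- u) v = - dot u v.
Proof. by rewrite -scaleN1r dotZl mulN1r. Qed.

Lemma dotNr u v : dot u (- v) = - dot u v.
Proof. by rewrite dotC dotNl dotC. Qed.

Lemma dot_int k l : dot (intv k) (intv l) \is a Num.int.
Proof. by apply: rpred_sum => j _; rewrite !mxE rpredM// intr_int. Qed.

End Lattice.

Lemma lsubmx_intv (R : realType) d (p : 'rV[int]_(d + d)) :
  lsubmx (intv R p) = intv R (lsubmx p).
Proof. by apply/rowP => j; rewrite !mxE. Qed.

Lemma rsubmx_intv (R : realType) d (p : 'rV[int]_(d + d)) :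
  rsubmx (intv R p) = intv R (rsubmx p).
Proof. by apply/rowP => j; rewrite !mxE. Qed.

Section LatticeWeight.
Variable R : realType.

Definition weight1 (k : int) : R := (1 + k%:~R ^+ 2)^-1.

Lemma weight1_ge0 k : 0 <= weight1 k.
Proof. by rewrite invr_ge0 addr_ge0// sqr_ge0. Qed.

(** Telescoping: [1 / (1 + k^2) <= 2 / k - 2 / (k + 1)] for [k >= 1], counted
    for both signs of [k], plus the term at [0]. *)
Lemma sum_weight1 n :
  \sum_(i < n.*2.+1) weight1 (i%:Z - n%:Z) <= 5 - 4 / n.+1%:R.
Proof.
elim: n => [|n IH]; first by rewrite big_ord1 /weight1 subrr mulr0z expr0n addr0 invr1; lra.
rewrite doubleS big_ord_recl big_ord_recr/=.
rewrite (eq_bigr (fun i : 'I_n.*2.+1 => weight1 (i%:Z - n%:Z))); last first.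
  by move=> i _; congr weight1; rewrite /bump/=; lia.
have -> : weight1 (0%N%:Z - n.+1%:Z) = weight1 n.+1.
  by rewrite /weight1 sub0r mulrNz sqrrN.
have -> : weight1 ((bump 0 n.*2.+1)%:Z - n.+1%:Z) = weight1 n.+1.
  by congr weight1; rewrite /bump/= -muln2; lia.
suff : weight1 n.+1 <= 2 / n.+1%:R - 2 / n.+2%:R.
  by move: IH; set S := \sum_(i < _) _; move: (n.+1%:R^-1) (n.+2%:R^-1) => p q; lra.
rewrite /weight1 -[n.+2%:R]natr1; set x := n.+1%:~R.
have -> : n.+1%:R = x by [].
have x0 : 0 < x by rewrite ltr0z.
have -> : 2 / x - 2 / (x + 1) = 2 / (x * (x + 1)).
  by field; rewrite !gt_eqF//; lra.
rewrite -[leLHS]mul1r ler_pdivrMr ?ltr_wpDr ?sqr_ge0//.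
rewrite mulrAC ler_pdivlMr ?mulr_gt0//; first nra; lra.
Qed.

Variable d : nat.

Definition weight (k : 'rV[int]_d) : R := \prod_j weight1 (k 0 j).

Lemma weight_ge0 k : 0 <= weight k.
Proof. by apply: prodr_ge0 => j _; exact: weight1_ge0. Qed.

(** A finite set of lattice points lies in a cube, over which the sum of the
    product weight factors into one-dimensional sums. *)
Lemma bounded_sums_weight : bounded_sums weight.
Proof.
exists (5 ^+ d) => A.
pose n := (\sum_(k <- A) \sum_j `|k 0%R j|)%N.
have An k j : k \in A -> (`|k 0%R j| <= n)%N.
  move=> kA; rewrite /n (big_fsetD1 k)//= (bigD1 j)//=.
  by rewrite -addnA leq_addr.
pose emb (q : {ffun 'I_d -> 'I_(n.*2.+1)}) : 'rV[int]_d := \row_j ((q j)%:Z - n%:Z).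
pose T := [fset emb q | q in [set: {ffun 'I_d -> 'I_(n.*2.+1)}]%SET]%fset.
have embI : injective emb.
  move=> p q /rowP pq; apply/ffunP => j; apply/val_inj/eqP.
  by have := pq j; rewrite !mxE => /addIr [] /eqP.
have AT : (A `<=` T)%fset.
  apply/fsubsetP => k kA; apply/imfsetP => /=.
  exists [ffun j => inord `|(k 0 j + n%:Z)%R|%N] => //; first by rewrite inE.
  apply/rowP => j; have := An k j kA => kn; rewrite !mxE ffunE inordK; last by rewrite -muln2; lia.
  by move: (k 0 j) kn => z zn; lia.
apply: le_trans (sum_fset_sub weight_ge0 AT) _.
rewrite [leLHS](_ : _ = \prod_(j < d) \sum_(i < n.*2.+1) weight1 (i%:Z - n%:Z)); last first.
  rewrite /T big_imfset/=; last by move=> p q _ _; exact: embI.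
  rewrite big_enum_cond bigA_distr_bigA/=; apply: eq_big => [q|q _]; first by rewrite inE.
  by apply: eq_bigr => j _; rewrite mxE.
rewrite prodr_const card_ord lerXn2r ?nnegrE ?sumr_ge0// => [i _|]; first exact: weight1_ge0.
by apply: le_trans (sum_weight1 _) _; rewrite gerDl oppr_le0 divr_ge0.
Qed.

End LatticeWeight.

(** * Schwartz decay and complex continuity *)

Section Decay.
Variables (R : realType) (d : nat).
Implicit Types (f : 'rV[R]_d -> R[i]) (t : 'rV[R]_d).

(** The form in which decay is used: on bounded sets of [t], the translates
    [f (t + k)] are dominated by one summable family in [k]. *)
Definition locally_dominated f := forall B : R, exists C : R, forall t,
  (forall j, `|t 0 j| <= B) ->
  forall k, `|f (t + intv R k)| <= (C * weight R k)%:C%C.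

(** Expanding [\prod_j (1 + t_j^2)] gives finitely many monomials in [t], each
    controlled by a Schwartz seminorm. *)
Lemma schwartz_decay f : schwartz f -> exists C : R, forall t,
  `|f t| <= (C * \prod_j (1 + t 0 j ^+ 2)^-1)%:C%C.
Proof.
move=> [_ fS].
have /choice[c hc] (S : {set 'I_d}) := fS (fun j => if j \in S then 2 else 0)%N [::].
exists (\sum_(S in {set 'I_d}) c S) => t.
have t0 j : 0 < 1 + t 0 j ^+ 2 by rewrite ltr_wpDr// sqr_ge0.
have /complex_realP[r hr] : `|f t| \is Num.real by exact: normr_real.
rewrite hr lecR prodfV ler_pdivlMr ?prodr_gt0//.
under eq_bigr do rewrite addrC.
rewrite bigA_distr/= mulr_sumr; apply: ler_sum => S _.
have := hc S t; rewrite normrM/= hr normc_def/= expr0n addr0 sqrtr_sqr -rmorphM lecR.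
rewrite ger0_norm; last first.
  by apply: prodr_ge0 => j _; case: ifP => _; rewrite ?sqr_ge0.
rewrite mulrC; apply: le_trans; rewrite le_eqVlt; apply/orP; left; apply/eqP.
by congr (_ * _); apply: eq_bigr => j _; case: ifP => // _; rewrite expr0.
Qed.

(** Peetre's inequality [1 + y^2 <= 2 (1 + x^2) (1 + (x + y)^2)], coordinate by
    coordinate, moves the decay from [t + k] to [k]. *)
Lemma schwartz_locally_dominated f : schwartz f -> locally_dominated f.
Proof.
move=> /schwartz_decay[C fC] B; exists (C * (2 * (1 + B ^+ 2)) ^+ d) => t tB k.
apply: le_trans (fC _) _.
have C0 : 0 <= C.
  have := le_trans (normr_ge0 _) (fC 0); rewrite lecR pmulr_lge0//.
  by apply: prodr_gt0 => j _; rewrite invr_gt0 ltr_wpDr// sqr_ge0.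
rewrite lecR -mulrA ler_wpM2l//.
rewrite (_ : (2 * (1 + B ^+ 2)) ^+ d = \prod_(j < d) (2 * (1 + B ^+ 2))); last first.
  by rewrite prodr_const card_ord.
rewrite -big_split/=; apply: ler_prod => j _.
rewrite !mxE invr_ge0 addr_ge0 ?sqr_ge0//= /weight1.
have := tB j; move: (t 0 j) ((k 0 j)%:~R) => x y xB.
have xB2 : x ^+ 2 <= B ^+ 2.
  by rewrite -(real_normK (num_real x)) lerXn2r ?nnegrE ?(le_trans _ xB).
have p1 : 0 < 1 + (x + y) ^+ 2 by rewrite ltr_wpDr// sqr_ge0.
have p2 : 0 < 1 + y ^+ 2 by rewrite ltr_wpDr// sqr_ge0.
rewrite -[leLHS]mul1r ler_pdivrMr// mulrAC ler_pdivlMr// mul1r.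
have := sqr_ge0 (2 * x + y); have := sqr_ge0 (x + y); have := sqr_ge0 x.
nra.
Qed.

End Decay.

Section ComplexContinuity.
Variables (R : realType) (T : topologicalType).
Implicit Types (g h : T -> R[i]) (x : T).

(** Continuity of a complex-valued function, read on real and imaginary
    parts. *)
Definition ccontinuous_at g x :=
  complex.Re (g y) @[y --> x] --> complex.Re (g x) /\
  complex.Im (g y) @[y --> x] --> complex.Im (g x).

Lemma norm_Re_le (z : R[i]) (e : R) : `|z| < e%:C%C -> `|complex.Re z| < e.
Proof.
rewrite normc_def ltcR; apply: le_lt_trans; rewrite -sqrtr_sqr ler_sqrt ?lerDl ?sqr_ge0//.
by rewrite addr_ge0 ?sqr_ge0.
Qed.

Lemma norm_Im_le (z : R[i]) (e : R) : `|z| < e%:C%C -> `|complex.Im z| < e.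
Proof.
rewrite normc_def ltcR; apply: le_lt_trans; rewrite -sqrtr_sqr ler_sqrt ?lerDr ?sqr_ge0//.
by rewrite addr_ge0 ?sqr_ge0.
Qed.

Lemma norm_le_ReIm (z : R[i]) : `|z| <= (`|complex.Re z| + `|complex.Im z|)%:C%C.
Proof.
rewrite {1}[z]complexE; apply: le_trans (ler_normD _ _) _.
rewrite normrM (_ : `|'i%C| = 1); last by rewrite normc_def/= expr0n expr1n add0r sqrtr1.
by rewrite mul1r !normc_def/= expr0n !addr0 !sqrtr_sqr -rmorphD.
Qed.

Lemma ccontinuous_atP g x : ccontinuous_at g x <->
  (forall e : R, 0 < e -> \forall y \near x, `|g y - g x| < e%:C%C).
Proof.
split=> [[gr gi] e e0|h].
  have p0 : 0 < e / 2 by rewrite divr_gt0.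
  move/cvgrPdist_lt: gr => /(_ _ p0) gr; move/cvgrPdist_lt: gi => /(_ _ p0) gi.
  near=> y; rewrite distrC; apply: le_lt_trans (norm_le_ReIm _) _.
  by rewrite ltcR !raddfB (splitr e) ltrD//; near: y.
by split; apply/cvgrPdist_lt => e e0; near=> y; rewrite -raddfB;
  [apply: norm_Re_le|apply: norm_Im_le]; rewrite distrC; near: y; exact: h.
Unshelve. all: by end_near. Qed.

Lemma ccontinuous_cst (c : R[i]) x : ccontinuous_at (fun=> c) x.
Proof. by split; exact: cvg_cst. Qed.

Lemma ccontinuousD g h x : ccontinuous_at g x -> ccontinuous_at h x ->
  ccontinuous_at (fun y => g y + h y) x.
Proof.
move=> [gr gi] [hr hi]; split; rewrite raddfD/=;
  by under eq_fun do rewrite raddfD/=; exact: cvgD.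
Qed.

Lemma ccontinuousM g h x : ccontinuous_at g x -> ccontinuous_at h x ->
  ccontinuous_at (fun y => g y * h y) x.
Proof.
have ReM (a b : R[i]) : complex.Re (a * b) =
    complex.Re a * complex.Re b - complex.Im a * complex.Im b by case: a b => ? ? [].
have ImM (a b : R[i]) : complex.Im (a * b) =
    complex.Re a * complex.Im b + complex.Im a * complex.Re b by case: a b => ? ? [].
move=> [gr gi] [hr hi]; split.
  by rewrite ReM; under eq_fun do rewrite ReM; apply: cvgB; exact: cvgM.
by rewrite ImM; under eq_fun do rewrite ImM; apply: cvgD; exact: cvgM.
Qed.

Lemma ccontinuous_sum (I : Type) (s : seq I) (g : I -> T -> R[i]) x :
  (forall i, ccontinuous_at (g i) x) ->
  ccontinuous_at (fun y => \sum_(i <- s) g i y) x.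
Proof.
move=> gx; elim: s => [|i s IH].
  by under eq_fun do rewrite big_nil; exact: ccontinuous_cst.
by under eq_fun do rewrite big_cons; exact: ccontinuousD.
Qed.

Lemma ccontinuous_conj g x : ccontinuous_at g x ->
  ccontinuous_at (fun y => (g y)^*%C) x.
Proof.
have ReJ (z : R[i]) : complex.Re z^*%C = complex.Re z by case: z.
have ImJ (z : R[i]) : complex.Im z^*%C = - complex.Im z by case: z.
move=> [gr gi]; split; first by rewrite ReJ; under eq_fun do rewrite ReJ.
by rewrite ImJ; under eq_fun do rewrite ImJ; exact: cvgN.
Qed.

Lemma ccontinuous_e2pi (s : T -> R) x : s y @[y --> x] --> s x ->
  ccontinuous_at (fun y => e2pi (s y)) x.
Proof.
move=> sx; have cx : 2 * pi * s y @[y --> x] --> 2 * pi * s x.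
  by apply: cvgM => //; exact: cvg_cst.
by split; apply: continuous_cvg cx; [exact: continuous_cos|exact: continuous_sin].
Qed.

Lemma cvg_dot d (u v : T -> 'rV[R]_d) x :
  u y @[y --> x] --> u x -> v y @[y --> x] --> v x ->
  dot (u y) (v y) @[y --> x] --> dot (u x) (v x).
Proof.
move=> ux vx; rewrite /dot; elim: (index_enum _) => [|j s IH].
  by under eq_fun do rewrite big_nil; rewrite big_nil; exact: cvg_cst.
under eq_fun do rewrite big_cons; rewrite big_cons.
apply: cvgD IH; apply: cvgM.
  exact: (continuous_cvg _ (@coord_continuous R 1 d 0 j _) ux).
exact: (continuous_cvg _ (@coord_continuous R 1 d 0 j _) vx).
Qed.

End ComplexContinuity.

(** * The Zak transform *)

Section ZakTransform.
Variables (R : realType) (d : nat).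
Implicit Types (f : 'rV[R]_d -> R[i]) (t w : 'rV[R]_d) (k : 'rV[int]_d).

Definition zak_term f t w k : R[i] := f (t + intv R k) * e2pi (- dot (intv R k) w).

Definition zak f t w : R[i] := xget 0 [set S | has_sum (zak_term f t w) S].

Lemma norm_zak_term f t w k : `|zak_term f t w k| = `|f (t + intv R k)|.
Proof. by rewrite normrM norm_e2pi mulr1. Qed.

Lemma coord_le_norm (v : 'rV[R]_d) j : `|v 0 j| <= `|v|.
Proof.
rewrite [leRHS]mx_normrE.
exact: (le_bigmax _ (fun ij : 'I_1 * 'I_d => `|v ij.1 ij.2|) (0, j)).
Qed.

Lemma bounded_sums_scale (C : R) : bounded_sums (fun k => C * weight R k).
Proof.
have [B hB] := bounded_sums_weight R d.
exists (`|C| * B) => A; rewrite -mulr_sumr.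
have S0 : 0 <= \sum_(k <- A) weight R k by apply: sumr_ge0 => k _; exact: weight_ge0.
apply: le_trans (ler_wpM2l (normr_ge0 C) (hB A)).
by rewrite ler_wpM2r// ler_norm.
Qed.

Lemma has_sum_zak f t w : locally_dominated f -> has_sum (zak_term f t w) (zak f t w).
Proof.
move=> fd; have tB := coord_le_norm t; have [C hC] := fd `|t|.
have [|S hS] := @has_sum_dominated R _ _ (zak_term f t w) (bounded_sums_scale C).
  by move=> k; rewrite norm_zak_term hC.
by rewrite /zak; case: xgetP => [_ -> //|/(_ S)].
Qed.

Lemma zakE f t w S : locally_dominated f -> has_sum (zak_term f t w) S -> zak f t w = S.
Proof. by move=> fd; apply: has_sum_unique; exact: has_sum_zak. Qed.

(** The quasi-periodicity in time comes from translating the index of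
    summation by [n]. *)
Lemma zak_shift_time f t w (n : 'rV[int]_d) : locally_dominated f ->
  zak f (t + intv R n) w = e2pi (dot (intv R n) w) * zak f t w.
Proof.
move=> fd; apply: zakE => //.
rewrite (_ : zak_term _ _ _ = fun k => e2pi (dot (intv R n) w) *
    (zak_term f t w \o (fun k => n + k)) k).
  apply: has_sumZ; apply: (@has_sum_reindex _ _ _ (fun k => k - n)).
  - by move=> k; rewrite addrC addKr.
  - by move=> k; rewrite addrC subrK.
  exact: has_sum_zak.
apply/funext => k; rewrite /zak_term/= intvD addrA mulrCA -e2piD; congr (_ * e2pi _).
by rewrite dotDl; ring.
Qed.

Lemma zak_shift_freq f t w (n : 'rV[int]_d) : zak f t (w + intv R n) = zak f t w.
Proof.
rewrite /zak (_ : zak_term _ _ _ = zak_term f t w)//; apply/funext => k.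
rewrite /zak_term dotDr opprD e2piD (e2pi_int (s := - dot _ (intv R n))) ?mulr1//.
by rewrite rpredN dot_int.
Qed.

(** Lattice time-frequency shifts of [f] multiply its Zak transform by
    characters, whereas [M_beta T_alpha] translates it by [(- alpha, beta)] up
    to a unimodular factor. The linear relation thus reads
    [P * Zf = unimodular * Zf (. + (- alpha, beta))] with [P] a trigonometric
    polynomial, and zeros of [Zf] propagate forward along the orbit. *)
Lemma zak_zero_shift f (n : nat) (x y : 'I_n -> 'rV[R]_d) (c : 'I_n -> R[i])
    (alpha beta : 'rV[R]_d) :
  locally_dominated f ->
  (forall j, x j \in @int_lattice R d /\ y j \in @int_lattice R d) ->
  (forall t, \sum_(j < n) c j * modulation (y j) (translation (x j) f) t
     = modulation beta (translation alpha f) t) ->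
  forall t w, zak f t w = 0 -> zak f (t - alpha) (w + beta) = 0.
Proof.
move=> fd xyZ feq t w z0.
have zx j : zak f (t - x j) w = 0.
  have [/int_latticeP[l ->] _] := xyZ j.
  by rewrite -intvN zak_shift_time// z0 mulr0.
have hL : has_sum (fun k => \sum_(j < n) (c j * e2pi (- dot (y j) t)) * zak_term f (t - x j) w k) 0.
  have S0 : \sum_(j < n) (c j * e2pi (- dot (y j) t)) * zak f (t - x j) w = 0.
    by rewrite big1// => j _; rewrite zx mulr0.
  rewrite -[X in has_sum _ X]S0.
  apply: (has_sum_sum (index_enum 'I_n)
    (g := fun j k => c j * e2pi (- dot (y j) t) * zak_term f (t - x j) w k)) => j.
  by apply: has_sumZ; exact: has_sum_zak.
have hR : has_sum (fun k => e2pi (- dot beta t) * zak_term f (t - alpha) (w + beta) k)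
    (e2pi (- dot beta t) * zak f (t - alpha) (w + beta)).
  by apply: has_sumZ; exact: has_sum_zak.
suff E : (fun k => \sum_(j < n) (c j * e2pi (- dot (y j) t)) * zak_term f (t - x j) w k) =
  (fun k => e2pi (- dot beta t) * zak_term f (t - alpha) (w + beta) k).
  rewrite E in hL; have /eqP := has_sum_unique hR hL.
  by rewrite mulf_eq0 (negbTE (e2pi_neq0 _)) => /eqP.
apply/funext => k.
have := feq (t + intv R k); rewrite /modulation /translation.
move=> /(congr1 (fun z => e2pi (- dot (intv R k) w) * z)); rewrite mulr_sumr.
have mE (v : 'rV[R]_d) : expi (- (2 * pi * dot v (t + intv R k))) =
    e2pi (- dot v t) * e2pi (- dot v (intv R k)).
  by rewrite -e2piD -opprD -dotDr /e2pi mulrN.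
move=> h; transitivity (e2pi (- dot (intv R k) w) *
   (expi (- (2 * pi * dot beta (t + intv R k))) * f (t + intv R k - alpha))).
  rewrite -h; apply: eq_bigr => j _; rewrite mE.
  have [_ /int_latticeP[l ->]] := xyZ j.
  rewrite [e2pi (- dot (intv R l) (intv R k))]e2pi_int ?rpredN ?dot_int// mulr1.
  by rewrite /zak_term [t - x j + _]addrAC; ring.
rewrite mE /zak_term [t - alpha + _]addrAC (dotDr w beta) opprD e2piD (dotC beta (intv R k)).
by ring.
Qed.


Lemma ccontinuous_zak_term f k (T : topologicalType) (t w : T -> 'rV[R]_d) (x : T) :
  ccontinuous_at f (t x + intv R k) ->
  t y @[y --> x] --> t x -> w y @[y --> x] --> w x ->
  ccontinuous_at (fun y => zak_term f (t y) (w y) k) x.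
Proof.
move=> [fr fi] tx wx; apply: ccontinuousM.
  have tkx : t y + intv R k @[y --> x] --> t x + intv R k.
    by apply: cvgD => //; exact: cvg_cst.
  split; first exact: (cvg_comp (fun y => t y + intv R k) (fun z => complex.Re (f z)) tkx fr).
  exact: (cvg_comp (fun y => t y + intv R k) (fun z => complex.Im (f z)) tkx fi).
by apply: ccontinuous_e2pi; apply: cvgN; apply: cvg_dot => //; exact: cvg_cst.
Qed.

(** Uniform convergence on bounded sets (the Weierstrass test). *)
Lemma ccontinuous_zak f (T : topologicalType) (t w : T -> 'rV[R]_d) (x : T) :
  locally_dominated f -> (forall s, ccontinuous_at f s) ->
  t y @[y --> x] --> t x -> w y @[y --> x] --> w x ->
  ccontinuous_at (fun y => zak f (t y) (w y)) x.
Proof.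
move=> fd fc tx wx; apply/ccontinuous_atP => e e0.
have [C hC] := fd (`|t x| + 1).
have p0 : 0 < e / 5 by rewrite divr_gt0.
have [A0 hA0] : exists A0 : {fset 'rV[int]_d}, forall A, (A0 `<=` A)%fset ->
    \sum_(k <- A) `|C| * weight R k - \sum_(k <- A0) `|C| * weight R k < e / 5.
  apply: (small_tails _ (bounded_sums_scale _)) => // k.
  by rewrite mulr_ge0// weight_ge0.
have tail y : (forall j, `|t y 0 j| <= `|t x| + 1) ->
    `|zak f (t y) (w y) - \sum_(k <- A0) zak_term f (t y) (w y) k| < (e / 5 + e / 5)%:C%C.
  move=> ty; apply: (has_sum_tail _ hA0 (has_sum_zak _ _ fd) p0) => k.
  rewrite norm_zak_term; apply: le_trans (hC _ ty k) _.
  by rewrite lecR ler_wpM2r ?weight_ge0// ler_norm.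
have /ccontinuous_atP/(_ _ p0) fin :
    ccontinuous_at (fun y => \sum_(k <- A0) zak_term f (t y) (w y) k) x.
  by apply: ccontinuous_sum => k; exact: ccontinuous_zak_term.
have tnear : \forall y \near x, forall j, `|t y 0 j| <= `|t x| + 1.
  move/cvgrPdist_lt: tx => /(_ 1 ltr01) tx; near=> y => j.
  rewrite (_ : t y 0 j = t x 0 j - (t x - t y) 0 j); last by rewrite !mxE; ring.
  apply: le_trans (ler_normB _ _) _; rewrite lerD ?coord_le_norm//.
  by apply: le_trans (coord_le_norm _ _) _; apply: ltW; near: y.
near=> y.
have ty : forall j, `|t y 0 j| <= `|t x| + 1 by near: y.
have yfin : `|\sum_(k <- A0) zak_term f (t y) (w y) k -
  \sum_(k <- A0) zak_term f (t x) (w x) k| < (e / 5)%:C%C by near: y.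
have xb j : `|t x 0 j| <= `|t x| + 1.
  by apply: le_trans (coord_le_norm _ _) _; rewrite lerDl.
have := tail y ty; have := tail x xb; move: yfin.
move: (zak f (t y) (w y)) (zak f (t x) (w x)) (\sum_(k <- A0) zak_term f (t y) (w y) k)
  (\sum_(k <- A0) zak_term f (t x) (w x) k) => Zy Zx Sy Sx h1 h2 h3.
rewrite (_ : Zy - Zx = (Zy - Sy) + (Sy - Sx) - (Zx - Sx)); last by ring.
(* Two tails, each below 2 e / 5, and one finite sum below e / 5. *)
rewrite (_ : e = (e / 5 + e / 5) + e / 5 + (e / 5 + e / 5)); last by field.
apply: le_lt_trans (ler_normB _ _) _; rewrite rmorphD ltrD//.
by apply: le_lt_trans (ler_normD _ _) _; rewrite rmorphD ltrD.
Unshelve. all: by end_near. Qed.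

Lemma e2pi_sum (I : Type) (s : seq I) (g : I -> R) :
  e2pi (\sum_(i <- s) g i) = \prod_(i <- s) e2pi (g i).
Proof. by elim: s => [|i s IH]; rewrite ?big_nil ?e2pi0// !big_cons e2piD IH. Qed.

(** A geometric sum whose ratio is an [M]-th root of unity other than [1]. *)
Lemma sum_roots_of_unity (M : nat) (l : int) : (0 < `|l| < M)%N ->
  \sum_(i < M) e2pi (- (l%:~R * (i%:R / M%:R)) : R) = 0.
Proof.
move=> /andP[l0 lM]; have M0 : (M%:R : R) != 0 by rewrite pnatr_eq0; lia.
pose z : R[i] := e2pi (- (l%:~R / M%:R)).
rewrite (eq_bigr (fun i : 'I_M => z ^+ i)); last first.
  by move=> i _; rewrite e2piX; congr e2pi; rewrite -[RHS]mulr_natr; ring.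
have zM : z ^+ M = 1.
  rewrite e2piX e2pi_int// (_ : _ *+ M = - l%:~R) ?rpredN ?intr_int//.
  by rewrite -[LHS]mulr_natr mulNr divfK.
have z1 : z - 1 != 0.
  rewrite subr_eq0; apply/negP => /eqP/e2pi_eq1; rewrite rpredN => /intrP[m hm].
  have : (l%:~R : R) = (m * M%:Z)%:~R by rewrite intrM -hm; field.
  move/intr_inj => lm; move: l0 lM; rewrite lm abszM absz_nat.
  by case: `|m|%N => [|p]; rewrite ?mul0n// mulSn; lia.
by apply: (mulfI z1); rewrite mulr0 -subrX1 zM subrr.
Qed.

Definition grid_point (M : nat) (q : {ffun 'I_d -> 'I_M}) : 'rV[R]_d :=
  \row_j ((q j)%:R / M%:R).

Lemma sum_grid_character (M : nat) k : (forall j, (`|k 0%R j| < M)%N) -> k != 0 ->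
  \sum_(q : {ffun 'I_d -> 'I_M}) e2pi (- dot (intv R k) (grid_point q)) = 0.
Proof.
move=> kM k0; have /existsP[j kj] : [exists j, k 0 j != 0].
  apply: contraNT k0; rewrite negb_exists => /forallP h.
  by apply/eqP/rowP => j; apply/eqP; rewrite mxE; have := h j; rewrite negbK.
rewrite (eq_bigr (fun q : {ffun 'I_d -> 'I_M} =>
    \prod_j e2pi (- ((k 0 j)%:~R * ((q j)%:R / M%:R) : R)))); last first.
  by move=> q _; rewrite -e2pi_sum -sumrN; congr e2pi; apply: eq_bigr => i _; rewrite !mxE.
rewrite -(bigA_distr_bigA (fun j (i : 'I_M) => e2pi (- ((k 0 j)%:~R * (i%:R / M%:R) : R)))).
by rewrite (bigD1 j)//= sum_roots_of_unity ?mul0r// kM andbT absz_gt0.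
Qed.

(** Averaging [zak f t] over the frequencies in (1/M) Z^d keeps only the terms
    [f (t + k)] with [M] dividing [k]. For [M] large these are [f t] and a
    negligible tail, so [zak f t] cannot vanish identically. *)
Lemma zak_neq0 f t : locally_dominated f -> f t <> 0 -> exists w, zak f t w <> 0.
Proof.
move=> fd ft0; apply/existsNP => z0.
have tB := coord_le_norm t; have [C hC] := fd `|t|.
have [e e0 he] : exists2 e : R, 0 < e & (e + e)%:C%C <= `|f t|.
  have /complex_realP[r hr] : `|f t| \is Num.real by exact: normr_real.
  exists (r / 2); last by rewrite hr -splitr.
  by rewrite divr_gt0// -ltcR -hr normr_gt0; apply/eqP.
have u0 k : 0 <= `|C| * weight R k by rewrite mulr_ge0// weight_ge0.
have [A0 hA0] := small_tails u0 (bounded_sums_scale _) e0.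
pose A1 := (0 |` A0)%fset.
have hA1 A : (A1 `<=` A)%fset ->
    \sum_(k <- A) `|C| * weight R k - \sum_(k <- A1) `|C| * weight R k < e.
  move=> A1A; apply: le_lt_trans (hA0 A _); last first.
    by apply: fsubset_trans A1A; exact: fsubsetU1.
  by rewrite lerD2l lerN2 sum_fset_sub// fsubsetU1.
(* No nonzero index of A1 is divisible by M. *)
pose M := (\sum_(k <- A1) \sum_j `|k 0%R j|).+1%N.
have A1M k j : k \in A1 -> (`|k 0%R j| < M)%N.
  by move=> kA; rewrite /M ltnS (big_fsetD1 k)//= (bigD1 j)//= -addnA leq_addr.
pose D : R[i] := #|{ffun 'I_d -> 'I_M}|%:R.
have D0 : D != 0.
  rewrite pnatr_eq0 -lt0n; apply/card_gt0P; by exists [ffun=> ord0].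
pose g k := D^-1 * \sum_(q : {ffun 'I_d -> 'I_M}) zak_term f t (grid_point q) k.
have gE k : g k = f (t + intv R k) * (D^-1 *
    \sum_(q : {ffun 'I_d -> 'I_M}) e2pi (- dot (intv R k) (grid_point q))).
  by rewrite /g /zak_term -mulr_sumr mulrCA.
have hg : has_sum g 0.
  have -> : (0 : R[i]) = D^-1 * \sum_(q : {ffun 'I_d -> 'I_M}) zak f t (grid_point q).
    by rewrite big1 ?mulr0// => q _; apply: contrapT; exact: z0.
  apply: has_sumZ; apply: (has_sum_sum (index_enum {ffun 'I_d -> 'I_M})
    (g := fun q k => zak_term f t (grid_point q) k)) => q.
  exact: has_sum_zak.
have gle k : `|g k| <= (`|C| * weight R k)%:C%C.
  rewrite normrM normfV ler_pdivrMl ?normr_gt0//.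
  apply: le_trans (ler_norm_sum _ _ _) _.
  apply: (@le_trans _ _ (\sum_(q : {ffun 'I_d -> 'I_M}) (`|C| * weight R k)%:C%C)).
    apply: ler_sum => q _; rewrite norm_zak_term; apply: le_trans (hC _ tB k) _.
    by rewrite lecR ler_wpM2r ?weight_ge0// ler_norm.
  by rewrite sumr_const normr_nat mulr_natl.
have := has_sum_tail gle hA1 hg e0.
rewrite (big_fsetD1 0) ?fset1U1//= big_seq big1 => [|k]; last first.
  rewrite !inE => /andP[k0 kA1]; rewrite gE sum_grid_character ?mulr0// => j.
  by apply: A1M; rewrite !inE kA1.
rewrite gE intv0 !addr0.
rewrite (eq_bigr (fun=> 1)); last first.
  by move=> q _; rewrite dotC dot0r oppr0 e2pi0.
rewrite sumr_const -/D mulVf// mulr1 sub0r normrN => /lt_le_trans /(_ he).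
by rewrite ltxx.
Qed.

End ZakTransform.

(** * Closures of cyclic subgroups of the torus *)

Section Orbit.
Variables (R : realType) (n : nat).
Implicit Types (u v w xi : 'rV[R]_n) (p : 'rV[int]_n).

Lemma to_torus_eqP u v : to_torus u = to_torus v <-> exists p, u = v + intv R p.
Proof.
have -> : to_torus u = to_torus v <-> u - v \in @int_lattice R n.
  by rewrite Quotient.idealrBE; exact: (rwP eqP).
split=> [/int_latticeP[p hp]|[p ->]]; first by exists p; rewrite -hp addrC subrK.
by rewrite addrC addKr; apply/int_latticeP; exists p.
Qed.

Lemma to_torusD u v : to_torus (u + v) = to_torus u + to_torus v.
Proof. exact: Quotient.pi_add. Qed.

Lemma to_torus_surj (z : torus R n) : exists v, z = to_torus v.
Proof. by exists (repr z); rewrite /to_torus reprK. Qed.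

Lemma to_torus_continuous : continuous (@to_torus R n).
Proof. exact: pi_continuous. Qed.

Lemma open_torus (U : set (torus R n)) : open (@to_torus R n @^-1` U) -> open U.
Proof. by []. Qed.

Lemma open_to_torus (A : set 'rV[R]_n) : open A -> open (@to_torus R n @` A).
Proof.
move=> oA; apply: open_torus.
rewrite (_ : _ @^-1` _ = \bigcup_(p in [set: 'rV[int]_n]) ((fun u => u + intv R p) @^-1` A)).
  apply: bigcup_open => p _.
  have cp : continuous (fun u : 'rV[R]_n => u + intv R p).
    by move=> z; apply: continuousD; [move=> B; exact: id|exact: cst_continuous].
  by apply: open_comp => // u _; exact: cp.
apply/seteqP; split=> u /=.
  by move=> [v vA /to_torus_eqP[p vE]]; exists p => //=; rewrite -vE.
by move=> [p _ /= upA]; exists (u + intv R p) => //; apply/to_torus_eqP; exists p.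
Qed.

(** The preimage in R^n of the closure of the cyclic group generated by [xi]
    in the torus, described without the quotient. *)
Definition near_orbit xi v := forall e : R, 0 < e ->
  exists (k : int) p, `|v - xi *~ k - intv R p| < e.

Lemma orbit_closureP xi v :
  closure (range (fun k : int => to_torus (xi *~ k))) (to_torus v) <-> near_orbit xi v.
Proof.
split=> [clv e e0|nv B nB].
  have [] := clv (@to_torus R n @` ball v e).
    apply: open_nbhs_nbhs; split; first by apply: open_to_torus; exact: ball_open.
    by exists v => //; exact: ballxx.
  move=> _ [[k _ <-] [u uv /esym/to_torus_eqP[p hp]]]; exists k, (- p).
  move: uv; rewrite -ball_normE/= => uv; apply: le_lt_trans uv.
  by rewrite hp intvN opprK opprD addrA subrK.
have /nbhs_ballP[e /= e0 eB] : nbhs v (@to_torus R n @^-1` B) by exact: (to_torus_continuous nB).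
have [k [p kp]] := nv _ e0; exists (to_torus (xi *~ k)); split; first by exists k.
rewrite (_ : to_torus _ = to_torus (xi *~ k + intv R p)); last first.
  by apply/esym/to_torus_eqP; exists p.
by apply: eB; rewrite -ball_normE/= opprD addrA.
Qed.

Lemma near_orbit_lattice xi p : near_orbit xi (intv R p).
Proof. by move=> e e0; exists 0, p; rewrite mulr0z subr0 subrr normr0. Qed.

Lemma near_orbit_step xi : near_orbit xi xi.
Proof.
move=> e e0; exists 1, 0; rewrite mulr1z subrr.
by rewrite intv0 subrr normr0.
Qed.

Lemma near_orbitB xi u v : near_orbit xi u -> near_orbit xi v -> near_orbit xi (u - v).
Proof.
move=> hu hv e e0; have p0 : 0 < e / 2 by rewrite divr_gt0.
have [k [p kp]] := hu _ p0; have [l [q lq]] := hv _ p0.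
exists (k - l), (p - q); rewrite mulrzBr intvD intvN.
rewrite (_ : u - v - _ - _ = (u - xi *~ k - intv R p) - (v - xi *~ l - intv R q)).
  by apply: le_lt_trans (ler_normB _ _) _; rewrite (splitr e) ltrD.
move: (xi *~ k) (xi *~ l) (intv R p) (intv R q) => a b c g.
by rewrite !opprD !opprK !addrA; apply/rowP => j; rewrite !mxE; ring.
Qed.

Lemma near_orbit0 xi : near_orbit xi 0.
Proof. by rewrite -(subrr xi); apply: near_orbitB; exact: near_orbit_step. Qed.

Lemma near_orbitN xi v : near_orbit xi v -> near_orbit xi (- v).
Proof. by move=> hv; rewrite -sub0r; apply: near_orbitB => //; exact: near_orbit0. Qed.

Lemma near_orbitD xi u v : near_orbit xi u -> near_orbit xi v -> near_orbit xi (u + v).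
Proof. by move=> hu hv; rewrite -[v]opprK; apply: near_orbitB => //; exact: near_orbitN. Qed.

Lemma near_orbitMn xi v k : near_orbit xi v -> near_orbit xi (v *+ k).
Proof.
move=> hv; elim: k => [|k IH]; first exact: near_orbit0.
by rewrite mulrS; exact: near_orbitD.
Qed.

Lemma near_orbit_closed xi v :
  (forall e : R, 0 < e -> exists2 u, near_orbit xi u & `|v - u| < e) -> near_orbit xi v.
Proof.
move=> h e e0; have p0 : 0 < e / 2 by rewrite divr_gt0.
have [u hu uv] := h _ p0; have [k [p kp]] := hu _ p0; exists k, p.
rewrite (_ : v - _ - _ = (v - u) + (u - xi *~ k - intv R p)).
  by apply: le_lt_trans (ler_normD _ _) _; rewrite (splitr e) ltrD.
by rewrite !addrA subrK.
Qed.

Lemma mx_norm_lt (v : 'rV[R]_n) (e : R) : 0 < e -> (forall j, `|v 0 j| < e) -> `|v| < e.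
Proof.
move=> e0 ve; rewrite [ltLHS]mx_normrE; apply/bigmax_ltP; split=> //= -[i j] _ /=.
by rewrite ord1.
Qed.

(** Pigeonhole: cut the unit cube into [M^n] cells with [1 / M < e]; two
    multiples of [v] have fractional parts in the same cell. *)
Lemma dirichlet v (e : R) : 0 < e -> exists (q : nat) p, (0 < q)%N /\ `|v *+ q - intv R p| < e.
Proof.
move=> e0; pose M := (Num.truncn e^-1).+1.
have M0 : 0 < M%:R :> R by rewrite ltr0n.
have Me : M%:R^-1 < e.
  by rewrite invf_plt ?posrE//; exact: truncnS_gt.
pose fl (q : nat) j : int := Num.floor ((v *+ q) 0 j).
pose fr (q : nat) j : R := (v *+ q) 0 j - (fl q j)%:~R.
have fr01 q j : 0 <= fr q j < 1.
  have := real_floor_itv (num_real ((v *+ q) 0 j)); rewrite intrD => /andP[h1 h2].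
  by rewrite /fr /fl subr_ge0 h1/= ltrBlDl.
pose cell (q : 'I_(#|{ffun 'I_n -> 'I_M}|.+1)) : {ffun 'I_n -> 'I_M} :=
  [ffun j => inord (Num.truncn (M%:R * fr q j))].
have /injectivePn[q1 [q2 q12 cq]] : ~~ injectiveb cell.
  by apply/negP => /injectiveP/leq_card; rewrite card_ord ltnn.
wlog lt12 : q1 q2 q12 cq / (q1 < q2)%N.
  move=> W; case: (ltngtP q1 q2) => [|h|h]; first exact: W.
    by apply: (W q2 q1) => //; rewrite eq_sym.
  by move: q12; rewrite (val_inj h) eqxx.
exists (q2 - q1)%N, (\row_j (fl q2 j - fl q1 j)); split; first by rewrite subn_gt0.
apply: le_lt_trans Me; apply: ltW; apply: mx_norm_lt; first by rewrite invr_gt0.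
move=> j; have := congr1 (fun c : {ffun 'I_n -> 'I_M} => (c j : nat)) cq; rewrite !ffunE.
have tr q : (Num.truncn (M%:R * fr q j) < M)%N /\
   (Num.truncn (M%:R * fr q j))%:R <= M%:R * fr q j < (Num.truncn (M%:R * fr q j)).+1%:R.
  have /andP[f0 f1] := fr01 q j.
  have p0 : 0 <= M%:R * fr q j by rewrite mulr_ge0.
  have h := truncn_itv p0; split=> //.
  rewrite -(ltr_nat R); have /andP[h1 _] := h; apply: le_lt_trans h1 _.
  by rewrite gtr_pMr.
have [t1 /andP[l1 r1]] := tr q1; have [t2 /andP[l2 r2]] := tr q2.
rewrite !inordK// => tE; rewrite tE in l1 r1.
rewrite [X in `|X|](_ : _ = fr q2 j - fr q1 j); last first.
  by rewrite mulrnBr 1?ltnW// !mxE /fr intrB !mulmxnE; ring.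
rewrite -natr1 in r1 r2.
rewrite ltr_norml -(ltr_pM2l M0) -[X in _ && X](ltr_pM2l M0) mulrN divff ?gt_eqF//.
by rewrite mulrBr; apply/andP; split; lra.
Qed.

(** Forward multiples of [xi] suffice for the closure: a multiple of negative
    index is corrected by a large positive multiple of [xi] which is nearly
    integral. *)
Lemma near_orbit_forward xi v (e : R) : near_orbit xi v -> 0 < e ->
  exists (k : nat) p, `|v - xi *+ k - intv R p| < e.
Proof.
move=> hv e0; have p0 : 0 < e / 2 by rewrite divr_gt0.
have [[k|k] [p kp]] := hv _ p0.
  by exists k, p; apply: lt_trans kp _; lra.
have [q [r [q0 qr]]] := dirichlet (xi *+ k.+1) p0.
(* The positive multiple q (k + 1) of xi is nearly the lattice point r. *)
exists (k.+1 * q - k.+1)%N, (p - r).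
rewrite (_ : v - _ - _ = (v - xi *~ Negz k - intv R p) - (xi *+ k.+1 *+ q - intv R r)).
  by apply: le_lt_trans (ler_normB _ _) _; rewrite (splitr e) ltrD.
rewrite NegzE mulrNz mulrnBr; last by rewrite leq_pmulr.
rewrite mulrnA intvD intvN; apply/rowP => j; rewrite !mxE; ring.
Qed.

End Orbit.

(** * Phases and the area-perimeter comparison *)

Section Phase.
Variable R : realType.

Definition phase (z : R[i]) : R := atan (complex.Im z / complex.Re z) / (2 * pi).

Lemma polar (z : R[i]) : 0 < complex.Re z -> z = `|z| * e2pi (phase z).
Proof.
case: z => a b /= a0; have p0 := @pi_gt0 R.
rewrite /e2pi /phase/= mulrCA divff ?mulr1; last by rewrite mulf_neq0// gt_eqF.
set x := b / a; have xE : b = a * x by rewrite /x mulrCA divff ?mulr1// gt_eqF.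
have s0 : 0 < 1 + x ^+ 2 by rewrite ltr_wpDr// sqr_ge0.
have q0 : Num.sqrt (1 + x ^+ 2) != 0 by rewrite gt_eqF// sqrtr_gt0.
have nE : Num.sqrt (a ^+ 2 + b ^+ 2) = a * Num.sqrt (1 + x ^+ 2).
  rewrite xE (_ : a ^+ 2 + _ = a ^+ 2 * (1 + x ^+ 2)); last by ring.
  by rewrite sqrtrM ?sqr_ge0// sqrtr_sqr gtr0_norm.
have sE : sin (atan x) = x * cos (atan x).
  by have := atanK x; rewrite /tan => {2}<-; rewrite divfK// cos_atan invr_eq0.
rewrite normc_def /= nE /expi sE cos_atan.
apply/eqP; rewrite eq_complex/= !mul0r subr0 addr0; apply/andP; split; apply/eqP.
  by field.
by rewrite [LHS]xE; field.
Qed.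

(** The hypothesis puts [z] in the open cone of half-angle [pi / 4] about the
    positive real axis. *)
Lemma phase_small (z : R[i]) : `|complex.Im z| < complex.Re z -> `|phase z| < 8^-1.
Proof.
move=> h; have p0 := @pi_gt0 R.
have r0 : 0 < complex.Re z by apply: le_lt_trans h.
rewrite /phase normrM [X in _ * X]gtr0_norm ?invr_gt0 ?mulr_gt0// ltr_pdivrMr ?mulr_gt0//.
rewrite (_ : 8^-1 * (2 * pi) = pi / 4 :> R); last by field.
have : `|complex.Im z / complex.Re z| < 1.
  by rewrite normrM normfV (gtr0_norm r0) ltr_pdivrMr// mul1r.
rewrite !ltr_norml => /andP[/(lt_atan) l1 /lt_atan l2].
by rewrite -atan1 -atanN l1 l2.
Qed.

Lemma polar_eq (r r' : R[i]) (s s' : R) : 0 < r -> 0 < r' ->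
  r * e2pi s = r' * e2pi s' -> s - s' \is a Num.int.
Proof.
move=> r0 r'0 E; have rr : r = r'.
  by have := congr1 Num.norm E; rewrite !normrM !norm_e2pi !mulr1 !gtr0_norm.
apply: e2pi_eq1; move: E; rewrite rr => /(mulfI (lt0r_neq0 r'0)) E.
by rewrite e2piD E -e2piD subrr e2pi0.
Qed.

Lemma int_small_eq0 (s : R) : s \is a Num.int -> `|s| < 1 -> s = 0.
Proof.
move=> /intrP[m ->]; rewrite -intr_norm ltrz1 => m1.
by have -> : m = 0 by lia.
Qed.

(** A discrete Stokes formula. Each unit cell of an [n x n] grid has the same
    circulation [s]; the interior edges cancel, so [n^2 s] equals a boundary
    sum, which is only of order [n]. *)
Lemma area_le_perimeter (p q : nat -> nat -> R) (s B : R) :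
  (forall i j, p i j + q i j.+1 - p i.+1 j - q i j = s) ->
  (forall i j, `|p i j| <= B) -> (forall i j, `|q i j| <= B) -> s = 0.
Proof.
move=> pq pB qB.
have main n : n.+1%:R * `|s| <= 4 * B.
  set N := n.+1; have N0 : 0 < N%:R :> R by rewrite ltr0n.
  rewrite -(ler_pM2l N0).
  have -> : N%:R * (N%:R * `|s|) = `|\sum_(i < N) \sum_(j < N) s|.
    by rewrite !sumr_const !card_ord !normrMn !mulr_natl.
  have -> : \sum_(i < N) \sum_(j < N) s =
      \sum_(j < N) (p 0%N j - p N j) + \sum_(i < N) (q i N - q i 0%N).
    transitivity (\sum_(i < N) \sum_(j < N) (p i j - p i.+1 j) +
                  \sum_(i < N) \sum_(j < N) (q i j.+1 - q i j)).
      rewrite -big_split; apply: eq_bigr => i _; rewrite -big_split/=.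
      by apply: eq_bigr => j _; rewrite -(pq i j); ring.
    congr (_ + _).
      rewrite exchange_big/=; apply: eq_bigr => j _.
      rewrite -(big_mkord xpredT (fun i => p i j - p i.+1 j)).
      under eq_bigr do rewrite -opprB.
      by rewrite sumrN telescope_sumr// opprB.
    apply: eq_bigr => i _.
    by rewrite -(big_mkord xpredT (fun j => q i j.+1 - q i j)) telescope_sumr.
  apply: le_trans (ler_normD _ _) _.
  have bound (g h : nat -> R) : (forall i, `|g i| <= B) -> (forall i, `|h i| <= B) ->
      `|\sum_(i < N) (g i - h i)| <= N%:R * (B + B).
    move=> gB hB; apply: le_trans (ler_norm_sum _ _ _) _.
    rewrite mulr_natl -[X in _ *+ X]card_ord -sumr_const; apply: ler_sum => i _.
    by apply: le_trans (ler_normB _ _) _; exact: lerD.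
  rewrite (_ : N%:R * (4 * B) = N%:R * (B + B) + N%:R * (B + B)); last by ring.
  apply: lerD; first by apply: (bound (p 0%N) (p N)) => i; exact: pB.
  by apply: (bound (q ^~ N) (q ^~ 0%N)) => i; exact: qB.
apply/eqP; rewrite -normr_le0 leNgt; apply/negP => s0.
have := main (Num.truncn (4 * B / `|s|)).
by apply/negP; rewrite -ltNge -ltr_pdivrMr// truncnS_gt.
Qed.

End Phase.

(** * Isotropy from a nowhere vanishing section *)

Section Isotropy.
Variables (R : realType) (d : nat).
Local Notation W := 'rV[R]_(d + d).
Implicit Types (a v w z : W) (F : W -> R[i]).

(** The symplectic form of R^(2d), time coordinates first. *)
Definition symp a v : R :=
  dot (lsubmx a) (rsubmx v) - dot (rsubmx a) (lsubmx v).

Definition quasi_periodic F := forall (p : 'rV[int]_(d + d)) w,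
  F (w + intv R p) = e2pi (dot (lsubmx (intv R p)) (rsubmx w)) * F w.

(** For small [v] and [F w != 0], the argument of [transport F w v] is the phase
    gained by [F] from [w] to [w + v]. The last factor is the parallel
    transport which makes this expression periodic in [w] whenever [F] is
    quasi-periodic. *)
Definition transport F w v : R[i] :=
  F (w + v) * (F w)^*%C * e2pi (- dot (lsubmx w) (rsubmx v)).

Lemma lsubD u v : lsubmx (u + v) = lsubmx u + lsubmx v.
Proof. exact: linearD. Qed.

Lemma rsubD u v : rsubmx (u + v) = rsubmx u + rsubmx v.
Proof. exact: linearD. Qed.

Lemma sympDr a u v : symp a (u + v) = symp a u + symp a v.
Proof. by rewrite /symp lsubD rsubD !dotDr; ring. Qed.

Lemma sympZl b a v : symp (b *: a) v = b * symp a v.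
Proof. by rewrite /symp !linearZ !dotZl -mulrBr. Qed.

Lemma sympNr a v : symp a (- v) = - symp a v.
Proof. by rewrite /symp !linearN !dotNr; ring. Qed.

Lemma transport_periodic F (p : 'rV[int]_(d + d)) w v : quasi_periodic F ->
  transport F (w + intv R p) v = transport F w v.
Proof.
have conjM (x y : R[i]) : (x * y)^*%C = x^*%C * y^*%C by exact: rmorphM.
move=> qF; rewrite /transport addrAC (qF p (w + v)) (qF p w) conjM e2pi_conj.
rewrite lsubD rsubD dotDl dotDr.
rewrite !opprD !e2piD.
set A := e2pi _; set B := e2pi (dot _ (rsubmx v)); set C := e2pi (- dot _ (rsubmx w)).
set D := e2pi _; set E := e2pi _.
have AC : C * A = 1 by exact: e2piNM.
have EB : E * B = 1 by exact: e2piNM.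
rewrite (_ : _ * _ = (C * A) * (E * B) * (F (w + v) * (F w)^*%C * D)); last by ring.
by rewrite AC EB !mul1r.
Qed.

Lemma transport0 F w : transport F w 0 = `|F w| ^+ 2.
Proof.
rewrite /transport addr0 linear0 dot0r oppr0 e2pi0 mulr1.
by rewrite -add_Re2_Im2; case: (F w) => a b /=; apply/eqP; rewrite eq_complex/=;
  apply/andP; split; apply/eqP; ring.
Qed.

(** The curvature of that transport: around a parallelogram the values of [F]
    cancel up to positive factors, and the exponentials leave [symp a v]. *)
Lemma transport_parallelogram F w a v :
  transport F w v * transport F (w + v) a * `|F (w + a)| ^+ 2 =
  transport F w a * transport F (w + a) v * `|F (w + v)| ^+ 2 * e2pi (symp a v).
Proof.
rewrite -!transport0 /transport !addr0 linear0 !dot0r oppr0 e2pi0 !mulr1.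
rewrite (addrAC w a v) !lsubD !dotDl !opprD /symp !e2piD.
rewrite (dotC (rsubmx a) (lsubmx v)).
set g1 := e2pi (- dot (lsubmx w) (rsubmx v)); set g2 := e2pi (- dot (lsubmx w) (rsubmx a)).
set g3 := e2pi (- dot (lsubmx v) _); set g4 := e2pi (- dot (lsubmx a) _).
set g5 := e2pi (dot (lsubmx a) _).
have h : g4 * g5 = 1 by exact: e2piNM.
rewrite [RHS](_ : _ = (g4 * g5) * (F (w + a) * (F w)^*%C * g2 * (F (w + v + a) * (F (w + a))^*%C
   * g1) * (F (w + v) * (F (w + v))^*%C) * g3)); last by ring.
by rewrite h; ring.
Qed.

Lemma ccontinuous_transport F w v : (forall u, ccontinuous_at F u) ->
  ccontinuous_at (fun p : W * W => transport F p.1 p.2) (w, v).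
Proof.
move=> Fc.
have c1 : p.1 @[p --> (w, v)] --> w by exact: cvg_fst.
have c2 : p.2 @[p --> (w, v)] --> v by exact: cvg_snd.
have comp (u : W * W -> W) : u p @[p --> (w, v)] --> u (w, v) ->
    ccontinuous_at (F \o u) (w, v).
  move=> cu; have [Fr Fi] := Fc (u (w, v)).
  split; first exact: (cvg_comp u (fun z => complex.Re (F z)) cu Fr).
  exact: (cvg_comp u (fun z => complex.Im (F z)) cu Fi).
apply: ccontinuousM; first apply: ccontinuousM.
- by apply: (comp (fun p => p.1 + p.2)); exact: cvgD.
- by apply: ccontinuous_conj; exact: (comp fst).
apply: ccontinuous_e2pi; apply: cvgN.
apply: (cvg_dot (u := fun p : W * W => lsubmx p.1) (v := fun p : W * W => rsubmx p.2)).
  exact: (continuous_cvg _ (@continuous_lsubmx R 1 d d w) c1).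
exact: (continuous_cvg _ (@continuous_rsubmx R 1 d d v) c2).
Qed.

(** By periodicity in [w] it is enough to consider the part of [z + L] in the
    unit cube. That part is compact, and near each of its points
    [transport F w v] is close to the positive number [`|F w|^2]. *)
Lemma transport_uniform F z (L : set W) : closed L ->
  (forall p v, L v -> L (v + intv R p)) ->
  quasi_periodic F -> (forall u, ccontinuous_at F u) ->
  (forall w, L (w - z) -> F w <> 0) ->
  exists2 e : R, 0 < e & forall w v, L (w - z) -> `|v| < e ->
    `|complex.Im (transport F w v)| < complex.Re (transport F w v).
Proof.
move=> clL LZ qF Fc F0.
pose K : set W := [set w | L (w - z) /\ forall j, 0 <= w 0 j <= 1].
have cK : compact K.
  apply: bounded_closed_compact.
    exists 1; split; first exact: num_real.
    move=> e e1 w [_ w01]; apply: ltW; apply: mx_norm_lt; first by lra.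
    by move=> j; have /andP[? ?] := w01 j; rewrite ger0_norm//; lra.
  apply: closedI.
    apply: preimage_closed => // w _; apply: continuousB; first by move=> A; exact: id.
    exact: cst_continuous.
  rewrite (_ : (fun w : W => _) = \bigcap_(j in [set: 'I_(d + d)])
     ((fun w : W => w 0 j) @^-1` [set x | 0 <= x <= 1])); last first.
    by apply/seteqP; split=> w /= h j; [move=> _; exact: h|exact: h].
  apply: closed_bigI => j _; apply: preimage_closed.
    by move=> w _; exact: coord_continuous.
  by rewrite (_ : [set x | _] = `[0, 1]%classic) ?set_itvcc//; exact: itv_closed.
pose P v w := `|complex.Im (transport F w v)| < complex.Re (transport F w v).
have /compact_near_coveringP cov := cK.
have : \forall v \near (0 : W), K `<=` P v.
  apply: (cov W (nbhs (0 : W)) P) => w [Lw _].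
  have F2 : 0 < `|F w| ^+ 2 by rewrite exprn_gt0// normr_gt0; apply/eqP; exact: F0.
  have [r0 rI] : 0 < complex.Re (`|F w| ^+ 2) /\ complex.Im (`|F w| ^+ 2) = 0.
    by move: F2; rewrite ltcE/= => /andP[/eqP].
  rewrite -(transport0 F w) in rI r0.
  have p0 : 0 < complex.Re (transport F w 0) / 2 by rewrite divr_gt0.
  have /ccontinuous_atP/(_ _ p0) := ccontinuous_transport w 0 Fc.
  apply: filterS => -[w' v] /= h.
  have := norm_Re_le h; have := norm_Im_le h; rewrite !raddfB/= rI subr0 /P.
  by rewrite [in X in _ -> X -> _]ltr_norml => h2 /andP[h1 _]; lra.
move=> /nbhs_ballP[e /= e0 eP]; exists e => // w v Lw ve.
(* Translate w into the unit cube. *)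
pose p : 'rV[int]_(d + d) := \row_j (- Num.floor (w 0 j)).
rewrite -(transport_periodic p w v qF); apply: eP.
  by rewrite -ball_normE/= sub0r normrN.
split; first by rewrite addrAC; exact: LZ.
move=> j; rewrite !mxE intrN; have := real_floor_itv (num_real (w 0 j)).
by rewrite intrD => /andP[? ?]; lra.
Qed.

Lemma dot_bound (u v : 'rV[R]_d) (B C : R) : (forall j, `|u 0 j| <= B) ->
  (forall j, `|v 0 j| <= C) -> `|dot u v| <= d%:R * (B * C).
Proof.
move=> uB vC; apply: le_trans (ler_norm_sum _ _ _) _.
rewrite mulr_natl -[X in _ *+ X]card_ord -sumr_const; apply: ler_sum => j _.
by rewrite normrM ler_pM.
Qed.

Lemma symp_small : exists2 e : R, 0 < e & forall a v, `|a| < e -> `|v| < e ->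
  `|symp a v| < 2^-1.
Proof.
(* The form is bounded by 2 d e^2 on vectors of norm e. *)
exists (4 * (d%:R + 1))^-1; first by rewrite invr_gt0 mulr_gt0// ltr_wpDl.
set e := _^-1 => a v ae ve.
have d0 : 0 <= d%:R :> R by [].
have eE : e * (4 * (d%:R + 1)) = 1 by rewrite mulVf// gt_eqF//; lra.
have e0 : 0 < e by apply: le_lt_trans ae.
have ca (u : W) : `|u| < e -> (forall j, `|lsubmx u 0 j| <= e) /\ (forall j, `|rsubmx u 0 j| <= e).
  move=> ue; split=> j; rewrite mxE; exact: le_trans (coord_le_norm _ _) (ltW ue).
have [la ra] := ca a ae; have [lv rv] := ca v ve.
rewrite /symp; apply: le_lt_trans (ler_normB _ _) _.
apply: le_lt_trans (lerD (dot_bound la rv) (dot_bound ra lv)) _.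
have : e <= 4^-1 by nra.
nra.
Qed.

(** A nowhere vanishing quasi-periodic [F] forces [symp] to vanish on small
    vectors of [L]. All phases along a grid with small sides [a] and [v] in [L]
    are below [1/8], so that the circulation around a cell, a priori congruent
    to [symp a v] modulo the integers, is equal to it; then the area of the
    grid is compared with its perimeter. *)
Lemma isotropic_near0 F z (L : set W) : closed L -> L 0 ->
  (forall u v, L u -> L v -> L (u + v)) -> (forall p, L (intv R p)) ->
  quasi_periodic F -> (forall u, ccontinuous_at F u) ->
  (forall w, L (w - z) -> F w <> 0) ->
  exists2 e : R, 0 < e & forall a v, L a -> L v -> `|a| < e -> `|v| < e -> symp a v = 0.
Proof.
move=> clL L0 LD LZ qF Fc F0.
have [e1 e10 he1] := transport_uniform clL (fun p v Lv => LD _ _ Lv (LZ p)) qF Fc F0.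
have [e2 e20 he2] := symp_small.
exists (Num.min e1 e2); first by rewrite lt_min e10.
move=> a v La Lv; rewrite !lt_min => /andP[a1 a2] /andP[v1 v2].
have LM u k : L u -> L (u *+ k).
  by move=> Lu; elim: k => [//|k IH]; rewrite mulrS; exact: LD.
pose pt i j := z + (a *+ i + v *+ j).
have Lpt i j : L (pt i j - z) by rewrite /pt addrAC subrr add0r; apply: LD; exact: LM.
have phE u i j : `|u| < e1 -> `|phase (transport F (pt i j) u)| < 8^-1.
  by move=> ue; apply: phase_small; exact: he1.
have pos u i j : `|u| < e1 -> 0 < complex.Re (transport F (pt i j) u).
  by move=> ue; apply: le_lt_trans (he1 _ _ (Lpt i j) ue).
apply: (area_le_perimeter (B := 8^-1)
  (p := fun i j => phase (transport F (pt i j) v))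
  (q := fun i j => phase (transport F (pt i j) a))); last 2 first.
- by move=> i j; exact/ltW/phE.
- by move=> i j; exact/ltW/phE.
move=> i j.
have ptS : pt i j.+1 = pt i j + v by rewrite /pt mulrS -!addrA (addrC v).
have Spt : pt i.+1 j = pt i j + a by rewrite /pt mulrS -!addrA; congr (_ + _); rewrite addrC -addrA.
have := transport_parallelogram F (pt i j) a v; rewrite -ptS -Spt.
have n0 u i' j' : `|u| < e1 -> 0 < `|transport F (pt i' j') u|.
  move=> ue; rewrite normr_gt0; apply/eqP => t0.
  by have := pos u i' j' ue; rewrite t0 ltxx.
have f0 i' j' : 0 < `|F (pt i' j')| ^+ 2.
  by rewrite exprn_gt0// normr_gt0; apply/eqP; exact: F0.
have := phE v i j v1; have := phE a i j.+1 a1; have := phE a i j a1; have := phE v i.+1 j v1.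
have := n0 v i j v1; have := n0 a i j.+1 a1; have := n0 a i j a1; have := n0 v i.+1 j v1.
have := f0 i.+1 j; have := f0 i j.+1; have := he2 a v a2 v2.
have := polar (pos v i j v1); have := polar (pos a i j.+1 a1).
have := polar (pos a i j a1); have := polar (pos v i.+1 j v1).
move: (symp a v) (transport F (pt i j) v) (transport F (pt i j.+1) a) (transport F (pt i j) a)
  (transport F (pt i.+1 j) v) (`|F (pt i j.+1)| ^+ 2) (`|F (pt i.+1 j)| ^+ 2).
move=> s q1 q2 q3 q4 g1 g2 E4 E3 E2 E1 sB g10 g20 r4 r3 r2 r1 t4 t3 t2 t1 E.
have qint : phase q1 + phase q2 - (phase q3 + phase q4 + s) \is a Num.int.
  apply: (polar_eq (r := `|q1| * `|q2| * g2) (r' := `|q3| * `|q4| * g1)).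
  - by rewrite !mulr_gt0.
  - by rewrite !mulr_gt0.
  rewrite !e2piD.
  transitivity ((`|q1| * e2pi (phase q1)) * (`|q2| * e2pi (phase q2)) * g2); first by ring.
  rewrite -E1 -E2 E {1}E3 {1}E4; ring.
apply/eqP; rewrite -subr_eq0; apply/eqP; apply: int_small_eq0; last first.
  move: sB t1 t2 t3 t4; rewrite !ltr_norml.
  by move=> /andP[? ?] /andP[? ?] /andP[? ?] /andP[? ?] /andP[? ?]; lra.
by rewrite (_ : _ - _ = phase q1 + phase q2 - (phase q3 + phase q4 + s)) //; ring.
Qed.

End Isotropy.

(** * The identity component and its cosets *)

Section Subgroup.
Variables (R : realType) (d : nat).
Local Notation W := 'rV[R]_(d + d).
Implicit Types (a v w z xi : W) (F : W -> R[i]).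

(** If [F] vanished at [w], it would vanish on the forward orbit of [w] modulo
    the lattice; this orbit accumulates at [z], because [z - w] also lies in
    the closed subgroup. *)
Lemma nonzero_on_orbit_closure F xi z : quasi_periodic F ->
  (forall u, ccontinuous_at F u) -> (forall w, F w = 0 -> F (w + xi) = 0) ->
  F z <> 0 -> forall w, near_orbit xi (w - z) -> F w <> 0.
Proof.
move=> qF Fc Fxi Fz w wz Fw; apply: Fz.
have Fk (k : nat) p : F (w + xi *+ k + intv R p) = 0.
  rewrite qF; suff -> : F (w + xi *+ k) = 0 by rewrite mulr0.
  by elim: k => [|k IH]; rewrite ?addr0// mulrSr addrA Fxi.
apply: contrapT => n0.
have /complex_realP[r hr] : `|F z| \is Num.real by exact: normr_real.
have r0 : 0 < r by rewrite -ltcR -hr normr_gt0; apply/eqP.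
have /ccontinuous_atP/(_ _ r0)/nbhs_ballP[e /= e0 he] := Fc z.
have [k [p kp]] := near_orbit_forward (near_orbitN wz) e0.
have := he (w + xi *+ k + intv R p).
rewrite -ball_normE/= Fk sub0r normrN hr ltxx => h.
apply: notF; apply: h; move: kp; rewrite opprB.
by rewrite !opprD !addrA.
Qed.

(** If [g] is a curve in the closed subgroup with velocity [a] at [0], then
    [n g (1 / (n (k + 1)))] lies in the subgroup and tends to [a / (k + 1)]. *)
Lemma tangent_line xi (K : set (torus R (d + d))) a :
  (forall w, K (to_torus w) -> near_orbit xi w) -> tangent_space K a ->
  forall k : nat, near_orbit xi (k.+1%:R^-1 *: a).
Proof.
move=> KL [g [g0 gd gD gK]] k; apply: near_orbit_closed => e e0.
have k0 : 0 < k.+1%:R :> R by rewrite ltr0n.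
have : h^-1 *: ((g \o shift 0) (h *: (1 : R^o)) - g 0) @[h --> 0^'] --> a.
  by rewrite -gD; exact: gd.
move/cvgrPdist_lt => /(_ _ e0); rewrite /= => /nbhs_ballP[t /= t0 ht].
pose n := (Num.truncn t^-1).+1; pose h : R := (n * k.+1)%:R^-1.
have n0 : 0 < n%:R :> R by rewrite ltr0n.
have h0 : 0 < h by rewrite invr_gt0 ltr0n.
have hlt : h < t.
  rewrite /h invf_plt ?posrE ?ltr0n//.
  apply: lt_le_trans (truncnS_gt _) _; rewrite ler_nat.
  by rewrite -/n leq_pmulr.
exists (g h *+ n); first by apply: near_orbitMn; apply: KL; exact: gK.
have := ht h; rewrite -ball_normE/= sub0r normrN gtr0_norm// => /(_ hlt).
rewrite (gt_eqF h0) => /(_ isT).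
rewrite g0 subr0 addr0 /GRing.scale/= mulr1 => hh.
rewrite (_ : k.+1%:R^-1 *: a - g h *+ n = k.+1%:R^-1 *: (a - h^-1 *: g h)).
  rewrite normrZ gtr0_norm ?invr_gt0//; apply: le_lt_trans hh.
  by rewrite ler_piMl// invf_le1// ler1n.
rewrite scalerBr scalerA /h invrK natrM mulrCA mulVf ?gt_eqF// mulr1 scaler_nat//.
Qed.

Lemma symp_int a (p : 'rV[int]_(d + d)) : a \in @int_lattice R (d + d) ->
  symp a (intv R p) \is a Num.int.
Proof.
move=> /int_latticeP[q ->]; rewrite /symp.
by rewrite !lsubmx_intv !rsubmx_intv rpredB// dot_int.
Qed.

Lemma to_torus0 n : to_torus (0 : 'rV[R]_n) = 0.
Proof. by apply: (addrI (to_torus 0)); rewrite -to_torusD !addr0. Qed.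

(** When [symp a] vanishes on small elements of the subgroup, integrality of
    [symp a] is a locally constant property on it, hence holds on the whole
    connected component of the identity. *)
Lemma symp_int_on_component xi a (e : R) :
  a \in @int_lattice R (d + d) -> 0 < e ->
  (forall v, near_orbit xi v -> `|v| < e -> symp a v = 0) ->
  forall v,
    identity_component (closure (range (fun k : int => to_torus (xi *~ k)))) (to_torus v) ->
    symp a v \is a Num.int.
Proof.
set H := closure _ => aZ e0 ae v H0v.
have HL u : H (to_torus u) <-> near_orbit xi u by exact: orbit_closureP.
have sub : identity_component H `<=` H by exact: connected_component_sub.
have symp_shift u p : (symp a (u + intv R p) \is a Num.int) = (symp a u \is a Num.int).
  by rewrite sympDr rpredDr// symp_int.
(* Image of the e-neighbourhood of the lifts which satisfy Q: an open set
   whose trace on H is the set of points satisfying Q. *)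
pose thick (Q : W -> Prop) : set (torus R (d + d)) :=
  @to_torus R (d + d) @` \bigcup_(u in [set u | near_orbit xi u /\ Q u]) ball u e.
have open_thick Q : open (thick Q).
  by apply: open_to_torus; apply: bigcup_open => u _; exact: ball_open.
have thickP Q u : (forall p, Q (u + intv R p)) -> near_orbit xi u -> thick Q (to_torus u).
  move=> Qu Lu; exists u => //; exists u; last exact: ballxx.
  by split => //; have := Qu 0; rewrite intv0 addr0.
have thick_symp Q u : near_orbit xi u -> thick Q (to_torus u) ->
    exists2 w, Q w & (symp a u \is a Num.int) = (symp a w \is a Num.int).
  move=> Lu [u' [w [Lw Qw]] wu' /to_torus_eqP[p uE]]; exists w => //.
  have Lu' : near_orbit xi u' by rewrite uE; apply: near_orbitD => //; exact: near_orbit_lattice.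
  rewrite -(symp_shift u p) -uE -[u'](subrK w) sympDr ae ?add0r//; first exact: near_orbitB.
  by move: wu'; rewrite -ball_normE/= distrC.
(* Both the integral points and their complement are open in H. *)
pose Q1 w := symp a w \is a Num.int; pose Q2 w := ~ Q1 w.
pose B := identity_component H `&` thick Q1.
have H00 : identity_component H 0.
  apply: connected_component_refl; rewrite -(to_torus0 (d + d)); apply/HL.
  exact: near_orbit0.
have : B = identity_component H.
  apply: (@component_connected _ H 0).
  - exists 0; split=> //; rewrite -(to_torus0 (d + d)); apply: thickP.
      by move=> p; rewrite /Q1 add0r symp_int.
    exact: near_orbit0.
  - by exists (thick Q1).
  - exists (~` thick Q2); first exact: open_closedC.
    apply/seteqP; split=> y [H0y]; have [u yE] := to_torus_surj y.
      move=> t1; split=> // t2; rewrite yE in H0y t1 t2.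
      have Lu : near_orbit xi u by apply/HL; exact: sub.
      have [w1 Qw1 E1] := thick_symp _ _ Lu t1; have [w2 Qw2 E2] := thick_symp _ _ Lu t2.
      by apply: Qw2; rewrite /Q1 -E2 E1.
    move=> t2; split=> //; rewrite yE in H0y t2 *.
    have Lu : near_orbit xi u by apply/HL; exact: sub.
    apply: (thickP) => // p; rewrite /Q1 symp_shift; apply: contrapT => nQ.
    by apply: t2; apply: (thickP) => // q; rewrite /Q2 /Q1 symp_shift.
move=> BE; move: H0v; rewrite -BE => -[H0v t1].
have Lv : near_orbit xi v by apply/HL; exact: sub.
by have [w Qw ->] := thick_symp _ _ Lv t1.
Qed.

(** Translation by [xi] permutes the [m] cosets. Summing [symp a] over coset
    representatives before and after the permutation gives the same value, and
    the two sums differ by [m * symp a xi] up to an integer. *)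
Lemma cosets_exponent xi a m (H0 : set (torus R (d + d))) :
  let H := closure (range (fun k : int => to_torus (xi *~ k))) in
  H0 0 -> (forall v, H0 (to_torus v) -> symp a v \is a Num.int) ->
  cosets H H0 #= `I_m -> symp a xi *+ m \is a Num.int.
Proof.
move=> H H00 H0a; rewrite card_eq_sym => /card_set_bijP[f [fH finj fsurj]].
have HL u : H (to_torus u) <-> near_orbit xi u by exact: orbit_closureP.
pose coset (u : W) := [set to_torus u + b | b in H0].
have /choice[r hr] : forall i : 'I_m, exists u, near_orbit xi u /\ f i = coset u.
  move=> i; have [y Hy fE] := fH i (ltn_ord i).
  by have [u yE] := to_torus_surj y; exists u; split; [apply/HL; rewrite -yE|rewrite -fE yE].
have /choice[s hs] : forall i : 'I_m, exists j : 'I_m, f j = coset (r i + xi).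
  move=> i; have [|j /= jm jE] := fsurj (coset (r i + xi)).
    exists (to_torus (r i + xi)) => //; apply/HL.
    by apply: near_orbitD; [case: (hr i)|exact: near_orbit_step].
  by exists (Ordinal jm).
have coset_shift u : coset u = [set b - to_torus xi | b in coset (u + xi)].
  apply/seteqP; split=> y /=.
    move=> [b H0b <-]; exists (to_torus (u + xi) + b); first by exists b.
    by rewrite to_torusD; apply/eqP; rewrite subr_eq addrAC.
  move=> [_ [b H0b <-] <-]; exists b => //; rewrite to_torusD.
  by apply/eqP; rewrite eq_sym subr_eq addrAC.
have sinj : injective s.
  move=> i j sij; apply/val_inj/finj; rewrite ?in_setE//=.
  by rewrite (hr i).2 (hr j).2 coset_shift -hs sij hs -coset_shift.
have main i : symp a (r i) + symp a xi - symp a (r (s i)) \is a Num.int.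
  have : coset (r i + xi) (to_torus (r i + xi)) by exists 0 => //; rewrite addr0.
  rewrite -hs (hr (s i)).2 => -[b H0b bE].
  rewrite -sympDr -sympNr -sympDr; apply: H0a.
  have -> : to_torus (r i + xi - r (s i)) = b; last by [].
  apply: (addrI (to_torus (r (s i)))); rewrite -to_torusD bE.
  by rewrite addrC subrK.
have : \sum_i (symp a (r i) + symp a xi - symp a (r (s i))) \is a Num.int.
  by apply: rpred_sum => i _; exact: main.
rewrite sumrB big_split/= -(reindex_inj sinj (P := xpredT) (F := fun i => symp a (r i))) /=.
by rewrite addrAC subrr add0r sumr_const card_ord.
Qed.

End Subgroup.

Theorem proposition6p2 (R : realType) (d N : nat)
    (hd : (1 <= d)%N) (hN : (2 <= N)%N)
    (x y : 'I_N.-1 -> 'rV[R]_d)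
    (hxy : forall k, x k \in @int_lattice R d /\ y k \in @int_lattice R d)
    (alpha beta : 'rV[R]_d)
    (hab : ~ (alpha \in @int_lattice R d /\ beta \in @int_lattice R d))
    (f : 'rV[R]_d -> R[i]) (hf0 : f <> cst 0) (hf : schwartz f)
    (c : 'I_N.-1 -> R[i])
    (heq : forall t : 'rV[R]_d,
      \sum_(k < N.-1) c k * modulation (y k) (translation (x k) f) t
      = modulation beta (translation alpha f) t) :
  let H := orbit_closure alpha beta in
  let H0 := identity_component H in
  infinite_set H -> H <> setT ->
  forall m : nat, cosets H H0 #= `I_m ->
  forall at_ aw : 'rV[R]_d,
    tangent_space H0 (row_mx at_ aw) ->
    row_mx at_ aw \in @int_lattice R (d + d) ->
    m%:R * (dot at_ beta + dot aw alpha) \is a Num.int.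
Proof.
move=> H H0 _ _ m hm at_ aw; set a := row_mx at_ aw => aT aZ.
pose xi := row_mx (- alpha) beta; pose L : set 'rV[R]_(d + d) := near_orbit xi.
have fd := schwartz_locally_dominated hf.
pose F w := zak f (lsubmx w) (rsubmx w).
have fc t : ccontinuous_at f t.
  have [fr fi] := hf.1 [::] t.
  by split; exact: differentiable_continuous.
have Fc u : ccontinuous_at F u.
  apply: ccontinuous_zak => //; first exact: continuous_lsubmx.
  exact: continuous_rsubmx.
have qF : quasi_periodic F.
  move=> p w; rewrite /F !linearD/=.
  by rewrite lsubmx_intv rsubmx_intv zak_shift_freq zak_shift_time.
have Fxi w : F w = 0 -> F (w + xi) = 0.
  rewrite /F !linearD/= row_mxKl row_mxKr.
  exact: (zak_zero_shift fd hxy heq).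
have [z Fz] : exists z, F z <> 0.
  have [t ft] : exists t, f t <> 0.
    by apply/existsNP => f0; apply: hf0; apply/funext.
  have [w zw] := zak_neq0 fd ft.
  by exists (row_mx t w); rewrite /F row_mxKl row_mxKr.
have FL := nonzero_on_orbit_closure qF Fc Fxi Fz.
have Lcl : closed L.
  move=> v clv; apply: near_orbit_closed => e e0.
  have [u [Lu]] := clv _ (nbhsx_ballx v e e0).
  by rewrite -ball_normE; exists u.
have [e e0 he] := isotropic_near0 Lcl (near_orbit0 xi) (@near_orbitD _ _ xi)
  (near_orbit_lattice xi) qF Fc FL.
have HL u : H (to_torus u) <-> near_orbit xi u by exact: orbit_closureP.
have sub : H0 `<=` H by exact: connected_component_sub.
have aL : forall k : nat, near_orbit xi (k.+1%:R^-1 *: a).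
  by apply: (tangent_line _ aT) => w /sub /HL.
(* a itself may be long: work with the short vector a / (k + 1). *)
pose k := Num.truncn (`|a| / e).
have k0 : 0 < k.+1%:R :> R by rewrite ltr0n.
have ka : `|k.+1%:R^-1 *: a| < e.
  rewrite normrZ gtr0_norm ?invr_gt0// mulrC ltr_pdivrMr// mulrC -ltr_pdivrMr//.
  exact: truncnS_gt.
have ae v : near_orbit xi v -> `|v| < e -> symp a v = 0.
  move=> Lv ve; have := he _ _ (aL k) Lv ka ve; rewrite sympZl => /eqP.
  by rewrite mulf_eq0 invr_eq0 (gt_eqF k0) => /eqP.
have H0a := symp_int_on_component aZ e0 ae.
have H00 : H0 0.
  apply: connected_component_refl; rewrite -(to_torus0 R (d + d)); apply/HL.
  exact: near_orbit0.
have := cosets_exponent H00 H0a hm.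
by rewrite /symp !row_mxKl !row_mxKr dotNr opprK mulr_natl.
Qed.
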